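(* For $n\ge0$ let $S_n(t)=\frac{(t-1)R_n(t)}{2n+\alpha+\beta+\gamma+1}+1$. Then for $t\in(0,1)$, $S_n$ satisfies the Painlevé VI equation \begin{align*} S_n''&=\frac12\left(\frac1{S_n}+\frac1{S_n-1}+\frac1{S_n-t}\right)(S_n')^2-\left(\frac1t+\frac1{t-1}+\frac1{S_n-t}\right)S_n'\\ &\quad+\frac{S_n(S_n-1)(S_n-t)}{t^2(t-1)^2}\left(\mu_1+\frac{\mu_2t}{S_n^2}+\frac{\mu_3(t-1)}{(S_n-1)^2}+\frac{\mu_4t(t-1)}{(S_n-t)^2}\right), \end{align*} with $\mu_1=\frac{(2n+\alpha+\beta+\gamma+1)^2}{2}$, $\mu_2=-\frac{\alpha^2}{2}$, $\mu_3=\frac{\beta^2}{2}$, $\mu_4=\frac{1-\gamma^2}{2}$.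
   Context: Fix $\alpha,\beta,\gamma>0$ and real constants $A,B$ with $A\ge0$, $A+B\ge0$, not both $A$ and $A+B$ equal to $0$. Let $\theta$ be the Heaviside function. For $t\in(0,1)$ put $w(x,t)=x^{\alpha}(1-x)^{\beta}|x-t|^{\gamma}(A+B\theta(x-t))$ on $[0,1]$. Let $P_n(x,t)$ be the monic polynomials of degree $n$ orthogonal w.r.t. $w(\cdot,t)$ on $[0,1]$, $\int_0^1P_mP_nw\,dx=h_n(t)\delta_{mn}$, and $R_n(t)=\frac{\beta}{h_n(t)}\int_0^1\frac{P_n^2(y,t)w(y,t)}{1-y}dy$. *)

(* Defs.v *)
From Stdlib Require Import Reals Lra ClassicalEpsilon.
Open Scope R_scope.

(* x^a for real a > 0, with the convention 0^a = 0 (Rpower uses ln, wrong at 0). *)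
Definition rpow (x a : R) : R :=
  if Rle_dec x 0 then 0 else Rpower x a.

(* Heaviside function (value at 0 irrelevant for the integrals below). *)
Definition heaviside (x : R) : R := if Rlt_dec x 0 then 0 else 1.

Definition weight (al be ga A B t x : R) : R :=
  rpow x al * rpow (1 - x) be * rpow (Rabs (x - t)) ga * (A + B * heaviside (x - t)).

Fixpoint sumlt (n : nat) (f : nat -> R) : R :=
  match n with O => 0 | S m => sumlt m f + f m end.

Definition monic_of_deg (p : R -> R) (k : nat) : Prop :=
  exists c : nat -> R, forall x, p x = x ^ k + sumlt k (fun j => c j * x ^ j).

Definition has_RInt (f : R -> R) (a b I : R) : Prop :=
  exists pr : Riemann_integrable f a b, RiemannInt pr = I.

Definition RInt (f : R -> R) (a b : R) : R :=
  epsilon (inhabits 0) (fun I => has_RInt f a b I).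

Definition has_ImpInt01 (f : R -> R) (I : R) : Prop :=
  (forall u, 0 < u < 1 -> exists J, has_RInt f 0 u J) /\
  limit1_in (fun u => RInt f 0 u) (fun u => 0 < u < 1) I 1.

Definition ImpInt01 (f : R -> R) : R :=
  epsilon (inhabits 0) (fun I => has_ImpInt01 f I).

Definition monic_orthogonal_family (al be ga A B : R) (P : nat -> R -> R -> R) : Prop :=
  forall t, 0 < t < 1 ->
    (forall k, monic_of_deg (P k t) k) /\
    (forall m k, m <> k ->
       has_RInt (fun x => P m t x * P k t x * weight al be ga A B t x) 0 1 0).

Definition h_n (al be ga A B : R) (P : nat -> R -> R -> R) (n : nat) (t : R) : R :=
  RInt (fun x => (P n t x) ^ 2 * weight al be ga A B t x) 0 1.

Definition R_n (al be ga A B : R) (P : nat -> R -> R -> R) (n : nat) (t : R) : R :=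
  be / h_n al be ga A B P n t *
  ImpInt01 (fun y => (P n t y) ^ 2 * weight al be ga A B t y / (1 - y)).

Definition S_n (al be ga A B : R) (P : nat -> R -> R -> R) (n : nat) (t : R) : R :=
  (t - 1) * R_n al be ga A B P n t / (2 * INR n + al + be + ga + 1) + 1.

Definition PVI_rhs (mu1 mu2 mu3 mu4 t S S1 : R) : R :=
  / 2 * (/ S + / (S - 1) + / (S - t)) * S1 ^ 2
  - (/ t + / (t - 1) + / (S - t)) * S1
  + S * (S - 1) * (S - t) / (t ^ 2 * (t - 1) ^ 2) *
    (mu1 + mu2 * t / S ^ 2 + mu3 * (t - 1) / (S - 1) ^ 2
     + mu4 * t * (t - 1) / (S - t) ^ 2).

(* Main.v *)
(* Attach to each pole s in {0, 1, t}, with exponent k_s in {al, be, ga}, the numbers p = P_n(s),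
   u = k_s int P_n w / (y - s), and q, v defined likewise from P_(n-1) / h_(n-1).  Pearson's
   equation w'/w = sum_s k_s / (x - s) gives the relations p v - q u = - k_s, sum p u = sum q v = 0,
   sum q u = - n and sum s p u = - (2n + 1 + al + be + ga) h_n.  By induction on n along the
   three-term recurrence, the numbers obey the Schlesinger equations in t; the base case is a linear
   differential system for the first two moments of the weight.  Since R_n = - p_1 u_1 / h_n, the
   function S_n is the zero of sum_s p_s u_s / (z - s), and Painleve VI follows by elimination.

   The factor |x - t|^ga is not differentiable at x = t, but y |y|^ga is continuously differentiable,
   so the moments are differentiated and integrated by parts after multiplication by factors that
   vanish at the singularities. *)
Require Import Defs.
From Stdlib Require Import Reals Lra Lia FunctionalExtensionality.
From Coquelicot Require Import Coquelicot.
Open Scope R_scope.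

(** * Polynomial functions of degree less than n *)

(** Nothing shows directly that P_n depends smoothly on t. The induction therefore differentiates
    only the numbers at the fixed poles 0 and 1, together with h_n. A quantity of the moving pole t
    that has to be differentiated is always one of the products p u, q v or the sum p v + q u, and
    the relations among the three poles express it by its counterparts at 0 and 1. The recurrence
    coefficient is likewise an explicit rational function of data of the same degree, so its
    derivative is known before the next degree is reached.

    The improper integrals behind u are avoided: a singular integral of f is replaced by f(s) e_s
    plus a regular integral, where the three constants e_s are combinations of the first two
    moments, forced by integration by parts of 1, x and x (x - 1). Only at the pole 1, where R_n
    requires it, is the result identified with an actual improper integral.

    Dividing P_(n-1) by h_(n-1) makes the step from degree n to n + 1 a matrix of determinant 1, and
    this is why the numbers p v - q u keep the value fixed by the exponents. *)

Fixpoint is_poly (n : nat) (f : R -> R) : Prop :=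
  match n with
  | O => forall x, f x = 0
  | S m => exists c g, is_poly m g /\ forall x, f x = c + x * g x
  end.

Lemma poly_ext n f g : (forall x, f x = g x) -> is_poly n f -> is_poly n g.
Proof.
  intros E; replace g with f; [tauto | now apply functional_extensionality].
Qed.

Lemma poly_zero n : is_poly n (fun _ => 0).
Proof.
  induction n as [|n IH]; simpl; [reflexivity|].
  exists 0, (fun _ => 0); split; [exact IH|intros; ring].
Qed.

Lemma poly_const n c : is_poly (S n) (fun _ => c).
Proof.
  exists c, (fun _ => 0); split; [apply poly_zero|intros; ring].
Qed.

Lemma poly_add n : forall f g, is_poly n f -> is_poly n g -> is_poly n (fun x => f x + g x).
Proof.
  induction n as [|n IH]; simpl; intros f g.
  - intros H1 H2 x; rewrite H1, H2; ring.
  - intros (c & f1 & Hf & E) (d & g1 & Hg & F).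
    exists (c + d), (fun x => f1 x + g1 x); split; [now apply IH|].
    intros x; rewrite E, F; ring.
Qed.

Lemma poly_scal n k : forall f, is_poly n f -> is_poly n (fun x => k * f x).
Proof.
  induction n as [|n IH]; simpl; intros f.
  - intros H x; rewrite H; ring.
  - intros (c & g & Hg & E).
    exists (k * c), (fun x => k * g x); split; [now apply IH|].
    intros x; rewrite E; ring.
Qed.

Lemma poly_sub n f g : is_poly n f -> is_poly n g -> is_poly n (fun x => f x - g x).
Proof.
  intros Hf Hg.
  apply (poly_ext _ (fun x => f x + (-1) * g x)); [intros; ring|].
  apply poly_add; [exact Hf | now apply poly_scal].
Qed.

Lemma poly_mulX n f : is_poly n f -> is_poly (S n) (fun x => x * f x).
Proof. intros H; exists 0, f; split; [exact H|intros; ring]. Qed.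

Lemma poly_S n : forall f, is_poly n f -> is_poly (S n) f.
Proof.
  induction n as [|n IH]; intros f H.
  - apply (poly_ext _ (fun _ => 0)); [intros; symmetry; apply H|apply poly_zero].
  - destruct H as (c & g & Hg & E); exists c, g; split; [now apply IH|exact E].
Qed.

Lemma poly_le m n f : (m <= n)%nat -> is_poly m f -> is_poly n f.
Proof. induction 1; intros; [assumption | apply poly_S; auto]. Qed.

Lemma poly_mul_linear n s f : is_poly n f -> is_poly (S n) (fun x => (x - s) * f x).
Proof.
  intros H; apply (poly_ext _ (fun x => x * f x + (- s) * f x)); [intros; ring|].
  apply poly_add; [now apply poly_mulX|].
  apply poly_scal, poly_S, H.
Qed.

Lemma poly_mul m n : forall f g, is_poly m f -> is_poly n g -> is_poly (m + n) (fun x => f x * g x).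
Proof.
  induction m as [|m IH]; intros f g.
  - intros Hf _; apply (poly_ext _ (fun _ => 0)); [|apply poly_zero].
    intros x; rewrite Hf; ring.
  - intros (c & h & Hh & E) Hg.
    apply (poly_ext _ (fun x => c * g x + x * (h x * g x))); [intros x; rewrite E; ring|].
    apply poly_add; [|now apply poly_mulX, IH].
    apply poly_scal, (poly_le n); [lia|exact Hg].
Qed.

Lemma poly_pow n : is_poly (S n) (fun x => x ^ n).
Proof. induction n as [|n IH]; [exact (poly_const 0 1)|exact (poly_mulX _ _ IH)]. Qed.

(** Synthetic division on the Horner form: if [g x = g s + (x - s) * k x], then [c + x * g x] minus
    its value at [s] is [(x - s) * (g s + x * k x)]. *)
Lemma poly_factor n s : forall f, is_poly (S n) f ->
  exists g, is_poly n g /\ forall x, f x = f s + (x - s) * g x.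
Proof.
  induction n as [|n IH]; intros f (c & g & Hg & E).
  - exists g; split; [exact Hg|]; intros x; simpl in Hg; rewrite !E, !Hg; ring.
  - destruct (IH g Hg) as (k & Hk & F).
    exists (fun x => g s + x * k x); split; [exists (g s), k; auto|].
    intros x; rewrite !E, (F x); ring.
Qed.

Lemma poly_deriv_S n : forall f, is_poly (S n) f ->
  exists f', is_poly n f' /\ forall x, is_derive f x (f' x).
Proof.
  induction n as [|n IH]; intros f (c & g & Hg & E).
  - exists (fun _ => 0); split; [simpl; auto|]; intros x.
    apply (is_derive_ext (fun _ => c)); [|apply @is_derive_const].
    intros; rewrite E, Hg; simpl; ring.
  - destruct (IH g Hg) as (g' & Hg' & D).
    exists (fun x => g x + x * g' x); split.
    + apply poly_add; [assumption|now apply poly_mulX].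
    + intros x; apply (is_derive_ext (fun x => c + x * g x)); [intros; symmetry; apply E|].
      pose proof (D x) as Dx.
      auto_derive; [exists (g' x); exact Dx|].
      replace (Derive _ x) with (g' x); [ring|]. symmetry; apply is_derive_unique, Dx.
Qed.

Lemma poly_continuous n f x : is_poly n f -> continuous f x.
Proof.
  intros H; destruct (poly_deriv_S n f (poly_S _ _ H)) as (f' & _ & D).
  apply @ex_derive_continuous; exists (f' x); apply D.
Qed.

(** Division at the midpoint [s] leaves a quotient that vanishes on [(s, b)], so the degree drops
    while an interval remains. An interval is all that positivity of the weight can supply. *)
Lemma poly_zero_on_interval n : forall f a b, is_poly n f -> a < b ->
  (forall x, a < x < b -> f x = 0) -> forall x, f x = 0.
Proof.
  induction n as [|n IH]; intros f a b Hf Hab Hz; [exact Hf|].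
  set (s := (a + b) / 2).
  destruct (poly_factor n s f Hf) as (g & Hg & E).
  assert (Hs : f s = 0) by (apply Hz; unfold s; lra).
  assert (G : forall x, g x = 0).
  { apply (IH g s b Hg); [unfold s; lra|].
    intros x Hx.
    assert (Fx : f x = 0) by (apply Hz; unfold s in Hx; lra).
    rewrite E, Hs in Fx.
    apply (Rmult_eq_reg_l (x - s)); lra. }
  intros x; rewrite E, Hs, G; ring.
Qed.

Definition monic (n : nat) (f : R -> R) : Prop :=
  exists g, is_poly n g /\ forall x, f x = x ^ n + g x.

Lemma monic_poly n f : monic n f -> is_poly (S n) f.
Proof.
  intros (g & Hg & E); apply (poly_ext _ (fun x => x ^ n + g x)); [intros; symmetry; apply E|].
  apply poly_add; [apply poly_pow | now apply poly_S].
Qed.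

Lemma monic_not_zero n : forall f, monic n f -> ~ (forall x, f x = 0).
Proof.
  induction n as [|n IH]; intros f (g & Hg & E) Z.
  - specialize (Z 0); rewrite E, Hg in Z; simpl in Z; lra.
  - destruct Hg as (c & h & Hh & F).
    assert (C : c = 0) by (specialize (Z 0); rewrite E, F in Z; simpl in Z; lra).
    assert (M : monic n (fun x => x ^ n + h x)) by (exists h; auto).
    apply (IH _ M).
    (* The factor [x] cancels only away from 0, and vanishing on (0, 1) is enough. *)
    apply (poly_zero_on_interval (S n) _ 0 1); [now apply monic_poly | lra |].
    intros x Hx; specialize (Z x); rewrite E, F, C in Z; simpl in Z.
    apply (Rmult_eq_reg_l x); lra.
Qed.

Lemma monic_of_deg_monic n f : monic_of_deg f n -> monic n f.
Proof.
  intros (c & E); exists (fun x => sumlt n (fun j => c j * x ^ j)); split; [|exact E].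
  clear E; induction n as [|n IH]; simpl sumlt; [simpl; reflexivity|].
  apply poly_add; [now apply poly_S|apply poly_scal, poly_pow].
Qed.

Lemma poly_top n : forall f, is_poly (S n) f ->
  exists c g, is_poly n g /\ forall x, f x = c * x ^ n + g x.
Proof.
  induction n as [|n IH]; intros f (c & g & Hg & E).
  - exists c, g; split; [exact Hg|]; intros x; rewrite E, Hg; simpl; ring.
  - destruct (IH g Hg) as (d & k & Hk & F).
    exists d, (fun x => c + x * k x); split; [exists c, k; auto|].
    intros x; rewrite E, F; simpl; ring.
Qed.

Lemma poly_sub_monic n f p : is_poly (S n) f -> monic n p ->
  exists c, is_poly n (fun x => f x - c * p x).
Proof.
  intros Hf (q & Hq & E).
  destruct (poly_top n f Hf) as (c & g & Hg & F).
  exists c; apply (poly_ext _ (fun x => g x - c * q x)).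
  - intros x; rewrite E, F; ring.
  - apply poly_sub; [assumption|now apply poly_scal].
Qed.

(** * Orthogonal polynomials for an abstract functional *)

(** With the derivative as value at [y = s], this agrees for a polynomial with the polynomial
    quotient at every point, so [L] can be applied to it as to that quotient. *)
Definition diff_quot (f : R -> R) (s y : R) : R :=
  if Req_EM_T y s then Derive f s else (f y - f s) / (y - s).

Lemma diff_quot_factor n c s f g : is_poly n g -> (forall x, f x = c + (x - s) * g x) ->
  diff_quot f s = g.
Proof.
  intros Hg E; apply functional_extensionality; intros y; unfold diff_quot.
  destruct (Req_EM_T y s) as [->|Hy].
  - destruct (poly_deriv_S n g (poly_S _ _ Hg)) as (g' & _ & D).
    apply is_derive_unique.
    apply (is_derive_ext (fun x => c + (x - s) * g x)); [intros; symmetry; apply E|].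
    pose proof (D s) as Ds.
    auto_derive; [exists (g' s); exact Ds|].
    ring.
  - rewrite !E; field; lra.
Qed.

(* For [L f = int f w] and [e = k * int w / (y - s)] this is
   [k * int f w / (y - s)], without an improper integral. *)
Definition pole_functional (L : (R -> R) -> R) (s k e : R) (f : R -> R) : R :=
  f s * e + k * L (diff_quot f s).

Section OrthogonalPolynomials.

Variable L : (R -> R) -> R.
Hypothesis L_plus : forall n f g, is_poly n f -> is_poly n g ->
  L (fun x => f x + g x) = L f + L g.
Hypothesis L_scal : forall n k f, is_poly n f -> L (fun x => k * f x) = k * L f.

Lemma L_ext f g : (forall x, f x = g x) -> L f = L g.
Proof. intros E; f_equal; now apply functional_extensionality. Qed.

Lemma L_lin n a b f g h : is_poly n f -> is_poly n g ->
  (forall x, h x = a * f x + b * g x) -> L h = a * L f + b * L g.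
Proof.
  intros Hf Hg E; rewrite (L_ext _ _ E).
  rewrite (L_plus n); try now apply poly_scal.
  rewrite !(L_scal n); auto.
Qed.

Lemma L_lin3 n a b c f g k h : is_poly n f -> is_poly n g -> is_poly n k ->
  (forall x, h x = a * f x + b * g x + c * k x) -> L h = a * L f + b * L g + c * L k.
Proof.
  intros Hf Hg Hk E.
  rewrite (L_lin n 1 c (fun x => a * f x + b * g x) k); auto.
  - rewrite (L_lin n a b f g (fun x => a * f x + b * g x)); auto; ring.
  - apply poly_add; now apply poly_scal.
  - intros; rewrite E; ring.
Qed.

Lemma L_zero f : (forall x, f x = 0) -> L f = 0.
Proof.
  intros E; rewrite (L_lin 0 0 0 f f f); auto; [ring|].
  intros x; rewrite E; ring.
Qed.

Section Pole.
Variables s k e : R.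
Notation E := (pole_functional L s k e).

Lemma pole_factor n c f g : is_poly n g -> (forall x, f x = c + (x - s) * g x) ->
  E f = c * e + k * L g.
Proof.
  intros Hg F; unfold pole_functional; rewrite (diff_quot_factor n c s f g Hg F), F; ring.
Qed.

Lemma pole_lin n a b f g h : is_poly n f -> is_poly n g ->
  (forall x, h x = a * f x + b * g x) -> E h = a * E f + b * E g.
Proof.
  intros Hf Hg F.
  destruct (poly_factor n s f (poly_S _ _ Hf)) as (f1 & Hf1 & Ef).
  destruct (poly_factor n s g (poly_S _ _ Hg)) as (g1 & Hg1 & Eg).
  rewrite (pole_factor n (f s) f f1 Hf1 Ef), (pole_factor n (g s) g g1 Hg1 Eg).
  rewrite (pole_factor n (a * f s + b * g s) h (fun x => a * f1 x + b * g1 x)).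
  - rewrite (L_lin n a b f1 g1 (fun x => a * f1 x + b * g1 x)); auto; ring.
  - apply poly_add; now apply poly_scal.
  - intros x; rewrite F, (Ef x), (Eg x); ring.
Qed.

Lemma pole_mul n f h : is_poly n f -> (forall x, h x = (x - s) * f x) -> E h = k * L f.
Proof.
  intros Hf F; rewrite (pole_factor n 0 h f Hf); [ring|].
  intros x; rewrite F; ring.
Qed.

End Pole.

(** * Integration by parts for a functional with three poles *)

Variables t al be ga e0 e1 et : R.
Notation m0 := (L (fun _ => 1)).
Notation m1 := (L (fun x => x)).
Hypothesis e_sum : e0 + e1 + et = 0.
Hypothesis e_moment0 : e1 + t * et = - (1 + al + be + ga) * m0.
Hypothesis e_moment1 : t * (t - 1) * et =
  (1 + al + ga * (1 - t)) * m0 - (2 + al + be + ga) * m1.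
Hypothesis L_total_derivative : forall n g g', is_poly n g -> is_poly n g' ->
  (forall x, is_derive g x (g' x)) ->
  L (fun x => x * (x - 1) * (x - t) * g' x
     + ((1 + al) * (x - 1) * (x - t) + (1 + be) * x * (x - t) + (1 + ga) * x * (x - 1)) * g x)
  = 0.

Notation E0 := (pole_functional L 0 al e0).
Notation E1 := (pole_functional L 1 be e1).
Notation Et := (pole_functional L t ga et).

(* Pearson equation: w'/w = al/x + be/(x-1) + ga/(x-t). *)
Lemma integration_by_parts n f f' : is_poly n f -> (forall x, is_derive f x (f' x)) ->
  L f' + E0 f + E1 f + Et f = 0.
Proof.
  intros Hf Df.
  assert (Hf3 : is_poly (S (S (S n))) f) by (apply (poly_le n); [lia|exact Hf]).
  (* Newton form of [f] at the nodes 0, 1, t. The parts along 1, x and x (x - 1) are settled by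
     [e_sum], [e_moment0] and [e_moment1], the multiple of x (x - 1) (x - t) by
     [L_total_derivative]. *)
  destruct (poly_factor _ 0 f Hf3) as (f1 & Hf1 & F1).
  destruct (poly_factor _ 1 f1 Hf1) as (f2 & Hf2 & F2).
  destruct (poly_factor _ t f2 Hf2) as (g & Hg & F3).
  destruct (poly_deriv_S n g (poly_S _ _ Hg)) as (g' & Hg' & Dg).
  set (c0 := f 0) in *; set (c1 := f1 1) in *; set (c2 := f2 t) in *.
  set (M := S (S (S (S n)))).
  assert (Q1 : is_poly M (fun _ => 1)) by apply poly_const.
  assert (QX : is_poly M (fun x => x)).
  { apply (poly_le 2); [unfold M; lia|]. apply (poly_ext _ (fun x => x * 1)); [intros; ring|].
    apply poly_mulX, poly_const. }
  assert (QQ : forall r s, is_poly M (fun x => (x - r) * ((x - s) * g x))).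
  { intros r s; apply (poly_le (S (S n))); [unfold M; lia|].
    now apply poly_mul_linear, poly_mul_linear. }
  assert (EF : forall x, f x = c0 + c1 * x + c2 * x * (x - 1) + x * (x - 1) * (x - t) * g x).
  { intros x; rewrite F1, F2, F3; ring. }
  assert (Q2 : forall r s a b, is_poly M (fun x => a + b * x + (x - r) * ((x - s) * g x))).
  { intros r s a b.
    apply (poly_ext _ (fun x => (a * 1 + b * x) + (x - r) * ((x - s) * g x))); [intros; ring|].
    apply poly_add; [|apply QQ].
    apply poly_add; now apply poly_scal. }
  assert (LL : forall r s a b, L (fun x => a + b * x + (x - r) * ((x - s) * g x))
     = a * m0 + b * m1 + L (fun x => (x - r) * ((x - s) * g x))).
  { intros r s a b.
    rewrite (L_lin3 M a b 1 (fun _ => 1) (fun x => x) (fun x => (x - r) * ((x - s) * g x))); auto.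
    - ring.
    - intros; ring. }
  rewrite (pole_factor 0 al e0 M c0 f (fun x => (c1 - c2) + c2 * x + (x - 1) * ((x - t) * g x))); auto;
    [|intros x; rewrite EF; ring].
  rewrite (pole_factor 1 be e1 M (c0 + c1) f (fun x => c1 + c2 * x + (x - 0) * ((x - t) * g x))); auto;
    [|intros x; rewrite EF; ring].
  rewrite (pole_factor t ga et M (c0 + c1 * t + c2 * t * (t - 1)) f
    (fun x => (c1 + c2 * (t - 1)) + c2 * x + (x - 0) * ((x - 1) * g x))); auto;
    [|intros x; rewrite EF; ring].
  rewrite !LL.
  set (W := fun x => x * (x - 1) * (x - t) * g' x
     + ((x - 1) * (x - t) + x * (x - t) + x * (x - 1)) * g x).
  assert (QW : is_poly M W).
  { apply (poly_ext _ (fun x => (x - 0) * ((x - 1) * ((x - t) * g' x))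
      + ((x - 1) * ((x - t) * g x) + ((x - 0) * ((x - t) * g x) + (x - 0) * ((x - 1) * g x)))));
      [intros; unfold W; ring|].
    apply poly_add; [|repeat apply poly_add; apply QQ].
    apply (poly_le (S (S (S n)))); [unfold M; lia|now repeat apply poly_mul_linear]. }
  assert (Ef' : forall x, f' x = (c1 - c2) * 1 + (2 * c2) * x + 1 * W x).
  { intros x.
    assert (D : is_derive f x ((c1 - c2) * 1 + (2 * c2) * x + 1 * W x)).
    { apply (is_derive_ext (fun x => c0 + c1 * x + c2 * x * (x - 1) + x * (x - 1) * (x - t) * g x));
        [intros; symmetry; apply EF|].
      pose proof (Dg x) as Dx.
      auto_derive; [exists (g' x); exact Dx|].
      replace (Derive _ x) with (g' x); [unfold W; ring|].
      symmetry; apply is_derive_unique, Dx. }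
    rewrite <- (is_derive_unique _ _ _ (Df x)); apply is_derive_unique. exact D. }
  rewrite (L_lin3 M (c1 - c2) (2 * c2) 1 (fun _ => 1) (fun x => x) W f'); auto.
  pose proof (L_total_derivative n g g' Hg Hg' Dg) as T.
  rewrite (L_lin3 M 1 1 1 W (fun x => al * ((x - 1) * ((x - t) * g x)))
     (fun x => be * ((x - 0) * ((x - t) * g x)) + ga * ((x - 0) * ((x - 1) * g x)))) in T;
    [|exact QW|now apply poly_scal|apply poly_add; now apply poly_scal
     |intros; unfold W; ring].
  rewrite (L_plus M) in T; try now apply poly_scal.
  rewrite !(L_scal M) in T; auto.
  assert (K0 : c0 * (e0 + e1 + et) = 0) by (rewrite e_sum; ring).
  assert (K1 : c1 * (e1 + t * et + (1 + al + be + ga) * m0) = 0) by (rewrite e_moment0; ring).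
  assert (K2 : c2 * (t * (t - 1) * et - (1 + al + ga * (1 - t)) * m0
    + (2 + al + be + ga) * m1) = 0) by (rewrite e_moment1; ring).
  lra.
Qed.

(** * Orthogonality and the three-term recurrence *)

Hypothesis L_sq_monic : forall n f, monic n f -> L (fun x => f x * f x) <> 0.
Variable P : nat -> R -> R.
Hypothesis P_monic : forall n, monic n (P n).
Hypothesis P_orth : forall m n, m <> n -> L (fun x => P m x * P n x) = 0.

Definition sq_norm (n : nat) : R := L (fun x => P n x * P n x).
Definition diag_coef (n : nat) : R := L (fun x => x * (P n x * P n x)) / sq_norm n.
(** The zero stands for P_(-1) and makes [three_term] hold from [n = 0] on. *)
Definition dual (n : nat) (x : R) : R :=
  match n with O => 0 | S m => P m x / sq_norm m end.

Lemma sq_norm_neq0 n : sq_norm n <> 0.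
Proof. apply (L_sq_monic n), P_monic. Qed.

Lemma P_poly n : is_poly (S n) (P n).
Proof. apply monic_poly, P_monic. Qed.

Lemma dual_poly n : is_poly n (dual n).
Proof.
  destruct n as [|n]; simpl dual; [apply poly_zero|].
  apply (poly_ext _ (fun x => / sq_norm n * P n x)); [intros; unfold dual, Rdiv; ring|].
  apply poly_scal, P_poly.
Qed.

Lemma P_orth_lower m : forall f n, (m <= n)%nat -> is_poly m f -> L (fun x => f x * P n x) = 0.
Proof.
  induction m as [|m IH]; intros f n Hmn Hf.
  - apply L_zero; intros x; rewrite Hf; ring.
  - destruct (poly_sub_monic m f (P m) Hf (P_monic m)) as (c & Hr).
    rewrite (L_lin (S m + S n) 1 c (fun x => (f x - c * P m x) * P n x)
      (fun x => P m x * P n x)).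
    + rewrite IH, P_orth; [ring|lia|lia|exact Hr].
    + apply poly_mul; [now apply poly_S|apply P_poly].
    + apply poly_mul; apply P_poly.
    + intros; ring.
Qed.

Lemma orth_all_lower_zero m : forall f, is_poly m f ->
  (forall k, (k < m)%nat -> L (fun x => f x * P k x) = 0) -> forall x, f x = 0.
Proof.
  induction m as [|m IH]; intros f Hf Ho; [exact Hf|].
  destruct (poly_sub_monic m f (P m) Hf (P_monic m)) as (c & Hr).
  assert (D : forall k, L (fun x => f x * P k x)
     = 1 * L (fun x => (f x - c * P m x) * P k x) + c * L (fun x => P m x * P k x)).
  { intros k; apply (L_lin (S m + S k)).
    - apply poly_mul; [now apply poly_S|apply P_poly].
    - apply poly_mul; apply P_poly.
    - intros; ring. }
  assert (Z : forall x, f x - c * P m x = 0).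
  { apply IH; [exact Hr|].
    intros k Hk; specialize (D k); rewrite Ho, P_orth in D; [lra|lia|lia]. }
  assert (C : c = 0).
  { specialize (D m); rewrite Ho in D; [|lia].
    rewrite (L_zero (fun x => (f x - c * P m x) * P m x)) in D; [|intros; rewrite Z; ring].
    apply (Rmult_eq_reg_r (sq_norm m)); [|apply sq_norm_neq0].
    unfold sq_norm; lra. }
  intros x; specialize (Z x); rewrite C in Z; lra.
Qed.

(** [x * P n x] is [P (S n) x] plus a polynomial of degree at most [n], which is orthogonal to
    [P (S n)]. *)
Lemma L_mulX_pred n : L (fun x => x * (P (S n) x * P n x)) = sq_norm (S n).
Proof.
  assert (Hx : is_poly (S (S n)) (fun x => x * P n x)) by apply poly_mulX, P_poly.
  destruct (P_monic n) as (g & Hg & Eg).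
  destruct (P_monic (S n)) as (g1 & Hg1 & Eg1).
  assert (Hr : is_poly (S n) (fun x => x * g x - g1 x)).
  { apply poly_sub; [now apply poly_mulX|exact Hg1]. }
  rewrite (L_lin (S (S n) + S (S n)) 1 1 (fun x => P (S n) x * P (S n) x)
    (fun x => (x * g x - g1 x) * P (S n) x)).
  - rewrite (P_orth_lower (S n) (fun x => x * g x - g1 x)); [unfold sq_norm; ring|lia|exact Hr].
  - apply poly_mul; apply P_poly.
  - apply poly_mul; [now apply poly_S|apply P_poly].
  - intros x; rewrite Eg1, Eg; simpl; ring.
Qed.

(** Both sides are monic of degree n + 1, so their difference has degree at most n, and it is
    orthogonal to every P_k with k <= n: for k = n by the choice of [diag_coef], for k = n - 1 by
    [L_mulX_pred], and below because x P_k has degree less than n. *)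
Lemma three_term n x : P (S n) x = (x - diag_coef n) * P n x - sq_norm n * dual n x.
Proof.
  set (a := diag_coef n); set (h := sq_norm n).
  assert (HX : forall y, P (S n) y - ((y - a) * P n y - h * dual n y) = 0);
    [|specialize (HX x); lra].
  assert (HD : is_poly (S n) (fun y => h * dual n y)) by apply poly_scal, poly_S, dual_poly.
  apply (orth_all_lower_zero (S n)).
  - destruct (P_monic n) as (g & Hg & Eg).
    destruct (P_monic (S n)) as (g1 & Hg1 & Eg1).
    apply (poly_ext _ (fun y => (g1 y - y * g y) + (a * P n y + h * dual n y))).
    + intros y; rewrite Eg1, Eg; simpl; ring.
    + apply poly_add; [apply poly_sub; [exact Hg1|now apply poly_mulX]|].
      apply poly_add; [apply poly_scal, P_poly|exact HD].
  - intros k Hk.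
    set (M := (S (S n) + S k)%nat).
    assert (Q : forall f, is_poly (S (S n)) f -> is_poly M (fun y => f y * P k y)).
    { intros f Hf; apply poly_mul; [exact Hf|apply P_poly]. }
    assert (Q0 : is_poly M (fun y => P (S n) y * P k y)) by apply Q, P_poly.
    assert (Q1 : is_poly M (fun y => (y * P n y) * P k y)) by (apply (Q (fun y => y * P n y)), poly_mulX, P_poly).
    assert (Q2 : is_poly M (fun y => P n y * P k y)) by apply Q, poly_S, P_poly.
    assert (Q3 : is_poly M (fun y => dual n y * P k y)).
    { apply Q; apply (poly_le n); [lia|apply dual_poly]. }
    rewrite (L_lin3 M 1 1 h (fun y => P (S n) y * P k y)
      (fun y => (-1) * ((y * P n y) * P k y) + a * (P n y * P k y))
      (fun y => dual n y * P k y)); [|exact Q0| |exact Q3|intros; ring].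
    2: apply poly_add; now apply poly_scal.
    rewrite (L_lin M (-1) a (fun y => (y * P n y) * P k y) (fun y => P n y * P k y)
      (fun y => (-1) * ((y * P n y) * P k y) + a * (P n y * P k y))); [|assumption..|intros; ring].
    rewrite (P_orth (S n) k) by lia.
    destruct (Nat.eq_dec k n) as [->|Hkn].
    + rewrite (L_ext (fun y => y * P n y * P n y) (fun x => x * (P n x * P n x))) by (intros; ring).
      rewrite (P_orth_lower n (dual n) n); [|lia|apply dual_poly].
      fold (sq_norm n); unfold a, diag_coef; field; apply sq_norm_neq0.
    + rewrite (P_orth n k) by lia.
      destruct n as [|m]; [lia|].
      destruct (Nat.eq_dec k m) as [->|Hkm].
      * rewrite (L_ext (fun y => y * P (S m) y * P m y) (fun x => x * (P (S m) x * P m x)))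
          by (intros; ring).
        rewrite L_mulX_pred.
        rewrite (L_lin (S m + S m) (/ sq_norm m) 0 (fun x => P m x * P m x) (fun x => P m x * P m x));
          [|apply poly_mul; apply P_poly|apply poly_mul; apply P_poly
           |intros; simpl; unfold Rdiv; ring].
        fold (sq_norm m); unfold h; field; apply sq_norm_neq0.
      * rewrite (L_ext (fun y => y * P (S m) y * P k y) (fun x => (x * P k x) * P (S m) x))
          by (intros; ring).
        rewrite (P_orth_lower (S (S k))); [|lia|apply poly_mulX, P_poly].
        rewrite (L_lin (S m + S k) (/ sq_norm m) 0 (fun x => P m x * P k x) (fun x => P m x * P k x));
          [|apply poly_mul; apply P_poly|apply poly_mul; apply P_poly
           |intros; simpl; unfold Rdiv; ring].
        rewrite (P_orth m k) by lia; ring.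
Qed.

(** * The recurrence at a pole *)

Section PoleRecurrence.
Variables s k e : R.
Notation E := (pole_functional L s k e).

(* The value [- k] at [n = 0], where [P_(-1) = 0], is the one that makes the three-term
   recurrence and the determinant [p v - q u = - k] valid from [n = 0] on. *)
Definition pole_dual (n : nat) : R :=
  match n with O => - k | S m => E (P m) / sq_norm m end.

Lemma L_P n : L (P n) = match n with O => sq_norm 0 | S _ => 0 end.
Proof.
  destruct n as [|n].
  - apply L_ext; intros x.
    destruct (P_monic 0) as (g & Hg & Eg); rewrite Eg, Hg; simpl; ring.
  - rewrite (L_ext _ (fun x => (fun _ => 1) x * P (S n) x)) by (intros; ring).
    apply (P_orth_lower 1); [lia|apply poly_const].
Qed.

(** The factor x - s turns [E] into [k * L (P n)], which orthogonality to constants kills for n >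
    0. *)
Lemma pole_three_term n :
  E (P (S n)) = (s - diag_coef n) * E (P n) - sq_norm n * pole_dual n.
Proof.
  set (a := diag_coef n); set (h := sq_norm n).
  assert (HX : is_poly (S (S n)) (fun x => (x - s) * P n x)) by apply poly_mul_linear, P_poly.
  assert (HP : is_poly (S (S n)) (P n)) by apply poly_S, P_poly.
  assert (HD : is_poly (S (S n)) (dual n)) by (apply (poly_le n); [lia|apply dual_poly]).
  rewrite (pole_lin s k e (S (S n)) 1 (-1) (fun x => (x - s) * P n x)
    (fun x => (a - s) * P n x + h * dual n x)); [|exact HX
    |apply poly_add; now apply poly_scal|intros x; rewrite three_term; fold a h; ring].
  rewrite (pole_lin s k e (S (S n)) (a - s) h (P n) (dual n) (fun x => (a - s) * P n x + h * dual n x)); auto.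
  rewrite (pole_mul s k e (S n) (P n)); [|apply P_poly|auto].
  rewrite L_P; destruct n as [|m]; simpl pole_dual.
  - rewrite (pole_lin s k e 0 0 0 (fun _ => 0) (fun _ => 0) (dual 0)); simpl; auto; [|intros; ring].
    fold h; ring.
  - rewrite (pole_lin s k e (S m) (/ sq_norm m) 0 (P m) (P m) (dual (S m))); try apply P_poly;
      [unfold Rdiv; ring|intros; simpl; unfold Rdiv; ring].
Qed.

(** One factor may be frozen at [s]: [P n x - P n s] is x - s times a quotient of degree less than
    [n], and that multiple contributes [k] times the integral of the quotient against [P n], which
    is 0. *)
Lemma pole_P_sq n : E (fun x => P n x * P n x) = P n s * E (P n).
Proof.
  destruct (poly_factor n s (P n) (P_poly n)) as (g & Hg & F).
  rewrite (pole_lin s k e (S n + S n) (P n s) 1 (P n) (fun x => (x - s) * (g x * P n x))).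
  - rewrite (pole_mul s k e (n + S n) (fun x => g x * P n x) (fun x => (x - s) * (g x * P n x))); auto.
    + rewrite (P_orth_lower n g n); auto; ring.
    + apply poly_mul; [exact Hg|apply P_poly].
  - apply (poly_le (S n)); [lia|apply P_poly].
  - apply (poly_le (S (n + S n))); [lia|].
    apply poly_mul_linear, poly_mul; [exact Hg|apply P_poly].
  - intros x.
    assert (K : P n x * P n x = P n x * (P n s + (x - s) * g x)) by (rewrite <- F; ring).
    rewrite K; ring.
Qed.

Lemma pole_mulX_P_sq n : E (fun x => x * (P n x * P n x)) = s * (P n s * E (P n)) + k * sq_norm n.
Proof.
  assert (Q : is_poly (S n + S n) (fun x => P n x * P n x)) by (apply poly_mul; apply P_poly).
  rewrite (pole_lin s k e (S (S n + S n)) s 1 (fun x => P n x * P n x)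
    (fun x => (x - s) * (P n x * P n x))).
  - rewrite (pole_mul s k e _ _ (fun x => (x - s) * (P n x * P n x)) Q) by auto.
    rewrite pole_P_sq; unfold sq_norm; ring.
  - now apply poly_S.
  - now apply poly_mul_linear.
  - intros; ring.
Qed.

End PoleRecurrence.

(** * Relations among the three poles *)

Lemma P_derive n : exists P', is_poly n P' /\ (forall x, is_derive (P n) x (P' x)) /\
  exists r, is_poly n r /\ forall x, x * P' x = INR n * P n x + r x.
Proof.
  destruct (P_monic n) as (g & Hg & Eg).
  destruct (poly_deriv_S n g (poly_S _ _ Hg)) as (g' & Hg' & Dg).
  destruct n as [|n].
  - exists (fun _ => 0); split; [apply poly_zero|split].
    + intros x; apply (is_derive_ext (fun _ => 1)); [|apply @is_derive_const].
      intros; rewrite Eg, Hg; simpl; ring.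
    + exists (fun _ => 0); split; [apply poly_zero|]; intros; simpl; ring.
  - destruct (poly_deriv_S n g Hg) as (k & Hk & Dk).
    exists (fun x => INR (S n) * x ^ n + k x); split; [|split].
    + apply poly_add; [apply poly_scal, poly_pow|now apply poly_S].
    + intros x; apply (is_derive_ext (fun x => x ^ S n + g x)); [intros; symmetry; apply Eg|].
      apply @is_derive_plus; [|apply Dk].
      auto_derive; [exact I|]. rewrite S_INR; destruct n; [simpl|]; ring.
    + exists (fun x => x * k x - INR (S n) * g x); split.
      * apply poly_sub; [now apply poly_mulX|now apply poly_scal].
      * intros x; rewrite Eg; simpl pow; ring.
Qed.

(** Integration by parts of P_n^2: its derivative 2 P_n P_n' is annihilated by orthogonality. *)
Lemma pole_sum_P n :
  P n 0 * E0 (P n) + P n 1 * E1 (P n) + P n t * Et (P n) = 0.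
Proof.
  destruct (P_derive n) as (P' & HP' & D & _).
  rewrite <- !pole_P_sq.
  assert (Q : is_poly (S n + S n) (fun x => P n x * P n x)) by (apply poly_mul; apply P_poly).
  assert (Q' : is_poly (n + S n) (fun x => P' x * P n x)) by (apply poly_mul; [exact HP'|apply P_poly]).
  pose proof (integration_by_parts _ _ (fun x => 2 * (P' x * P n x)) Q) as I.
  rewrite (L_scal _ _ _ Q'), (P_orth_lower n) in I; [|lia|exact HP'].
  lapply I; [lra|].
  intros x; pose proof (D x) as Dx.
  auto_derive; [repeat split; auto; exists (P' x); exact Dx|].
  replace (Derive _ x) with (P' x); [ring|].
  symmetry; apply is_derive_unique, Dx.
Qed.

(** Integration by parts of x P_n^2. The relation x P_n' = n P_n + lower terms contributes (2n + 1)
    h_n, and the terms k_s h_n of [pole_mulX_P_sq] add al + be + ga. *)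
Lemma pole_moment_P n :
  P n 1 * E1 (P n) + t * (P n t * Et (P n))
  = - (2 * INR n + 1 + al + be + ga) * sq_norm n.
Proof.
  destruct (P_derive n) as (P' & HP' & D & r & Hr & Er).
  pose proof (pole_mulX_P_sq 0 al e0 n) as F0.
  pose proof (pole_mulX_P_sq 1 be e1 n) as F1.
  pose proof (pole_mulX_P_sq t ga et n) as F2.
  assert (Q : is_poly (S n + S n) (fun x => P n x * P n x)) by (apply poly_mul; apply P_poly).
  assert (Qr : is_poly (S n + S n) (fun x => r x * P n x)).
  { apply poly_mul; [now apply poly_S|apply P_poly]. }
  pose proof (integration_by_parts _ _
    (fun x => (2 * INR n + 1) * (P n x * P n x) + 2 * (r x * P n x)) (poly_mulX _ _ Q)) as I.
  rewrite (L_lin _ (2 * INR n + 1) 2 _ _ _ Q Qr) in I; [|auto].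
  rewrite (P_orth_lower n r n) in I; [|lia|exact Hr].
  fold (sq_norm n) in I.
  rewrite F0, F1, F2 in I.
  lapply I; [lra|].
  intros x; pose proof (D x) as Dx.
  auto_derive; [repeat split; auto; exists (P' x); exact Dx|].
  replace (Derive _ x) with (P' x); [|symmetry; apply is_derive_unique, Dx].
  transitivity (P n x * P n x + 2 * (x * P' x) * P n x); [ring|].
  rewrite Er; ring.
Qed.

End OrthogonalPolynomials.

(** * Integration against the weight *)

Lemma continuous_Rmult (f g : R -> R) x :
  continuous f x -> continuous g x -> continuous (fun y => f y * g y) x.
Proof. exact (@continuous_mult R_UniformSpace R_AbsRing f g x). Qed.

Lemma continuous_Rplus (f g : R -> R) x :
  continuous f x -> continuous g x -> continuous (fun y => f y + g y) x.
Proof. exact (@continuous_plus R_UniformSpace R_AbsRing R_NormedModule f g x). Qed.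

Lemma continuous_Rminus (f g : R -> R) x :
  continuous f x -> continuous g x -> continuous (fun y => f y - g y) x.
Proof. exact (@continuous_minus R_UniformSpace R_AbsRing R_NormedModule f g x). Qed.

Lemma continuous_Ropp (f : R -> R) x :
  continuous f x -> continuous (fun y => - f y) x.
Proof. exact (@continuous_opp R_UniformSpace R_AbsRing R_NormedModule f x). Qed.

Lemma continuous_Rcomp (f g : R -> R) x :
  continuous g x -> continuous f (g x) -> continuous (fun y => f (g y)) x.
Proof. exact (@continuous_comp R_UniformSpace R_UniformSpace R_UniformSpace g f x). Qed.

Ltac continuity_step :=
  first [ assumption
        | apply continuous_const | apply continuous_id
        | apply continuous_Rmult | apply continuous_Rplus
        | apply continuous_Rminus | apply continuous_Ropp ].

(** The strong hypothesis is harmless for polynomial multiples of the weight: [rpow] extends the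
    powers by 0, continuously on the whole line. *)
Lemma ex_RInt_cont (f : R -> R) a b : (forall x, continuous f x) -> ex_RInt f a b.
Proof. intros H; apply (@ex_RInt_continuous R_CompleteNormedModule); auto. Qed.

Lemma RInt_of_derive (F f : R -> R) a b :
  (forall x, is_derive F x (f x)) -> (forall x, continuous f x) ->
  RInt f a b = F b - F a.
Proof.
  intros D C; apply is_RInt_unique, (is_RInt_derive F f); auto.
Qed.

Lemma RInt_lin (f g h : R -> R) (a b p q : R) :
  (forall x, continuous f x) -> (forall x, continuous g x) ->
  (forall x, h x = p * f x + q * g x) ->
  RInt h a b = p * RInt f a b + q * RInt g a b.
Proof.
  intros Cf Cg E.
  apply is_RInt_unique.
  apply (is_RInt_ext (fun x => p * f x + q * g x)); [intros; symmetry; apply E|].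
  apply (is_RInt_plus (fun x => p * f x) (fun x => q * g x) a b).
  - apply (is_RInt_scal f), (RInt_correct f), ex_RInt_cont, Cf.
  - apply (is_RInt_scal g), (RInt_correct g), ex_RInt_cont, Cg.
Qed.

(** * One-sided powers *)

Lemma rpow_pos x a : 0 < x -> rpow x a = Rpower x a.
Proof. intros H; unfold rpow; destruct (Rle_dec x 0); [lra|reflexivity]. Qed.

Lemma rpow_neg x a : x <= 0 -> rpow x a = 0.
Proof. intros H; unfold rpow; destruct (Rle_dec x 0); [reflexivity|lra]. Qed.

Lemma rpow_ge0 x a : 0 <= rpow x a.
Proof.
  unfold rpow; destruct (Rle_dec x 0); [lra|].
  apply Rlt_le, exp_pos.
Qed.

Lemma rpow_gt0 x a : 0 < x -> 0 < rpow x a.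
Proof. intros H; rewrite rpow_pos by exact H; apply exp_pos. Qed.

Lemma locally_gt (a x : R) : a < x -> locally x (fun y => a < y).
Proof.
  intros H; exists (mkposreal (x - a) ltac:(lra)); intros y Hy.
  apply Rabs_lt_between in Hy; unfold minus, plus, opp in Hy; simpl in Hy; lra.
Qed.

Lemma locally_lt (a x : R) : x < a -> locally x (fun y => y < a).
Proof.
  intros H; exists (mkposreal (a - x) ltac:(lra)); intros y Hy.
  apply Rabs_lt_between in Hy; unfold minus, plus, opp in Hy; simpl in Hy; lra.
Qed.

Lemma rpow_is_derive_pos x a : 0 < x -> is_derive (fun y => rpow y a) x (a * rpow x a / x).
Proof.
  intros Hx.
  apply (is_derive_ext_loc (fun y => exp (a * ln y))).
  - generalize (locally_gt 0 x Hx); apply filter_imp; intros y Hy.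
    now rewrite rpow_pos.
  - rewrite rpow_pos by exact Hx; unfold Rpower.
    auto_derive; [exact Hx|field; lra].
Qed.

Lemma rpow_small a eps : 0 < a -> 0 < eps ->
  exists d, 0 < d /\ forall y, y < d -> rpow y a < eps.
Proof.
  intros Ha He; exists (Rpower eps (/ a)); split; [apply exp_pos|].
  intros y Hy; destruct (Rle_lt_dec y 0) as [H|H]; [rewrite rpow_neg; lra|].
  rewrite rpow_pos by exact H.
  replace eps with (Rpower (Rpower eps (/ a)) a).
  - apply Rlt_Rpower_l; lra.
  - rewrite Rpower_mult, Rinv_l by lra; now apply Rpower_1.
Qed.

Lemma rpow_continuous a x : 0 < a -> continuous (fun y => rpow y a) x.
Proof.
  intros Ha; destruct (Rtotal_order x 0) as [H|[->|H]].
  - apply (continuous_ext_loc _ (fun _ => 0)); [|apply continuous_const].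
    generalize (locally_lt 0 x H); apply filter_imp; intros y Hy; rewrite rpow_neg; lra.
  - apply continuity_pt_filterlim; intros eps He.
    destruct (rpow_small a eps Ha He) as (d & Hd & Hs).
    exists d; split; [exact Hd|]; intros y [_ Hy]; simpl in *.
    unfold Rdist in *; rewrite (rpow_neg 0) by lra.
    rewrite Rminus_0_r in *; rewrite Rabs_pos_eq by apply rpow_ge0.
    apply Hs; apply Rabs_lt_between in Hy; lra.
  - apply @ex_derive_continuous; eexists; now apply rpow_is_derive_pos.
Qed.

Lemma mul_rpow_is_derive a x : 0 < a ->
  is_derive (fun y => y * rpow y a) x ((1 + a) * rpow x a).
Proof.
  intros Ha; destruct (Rtotal_order x 0) as [H|[->|H]].
  - apply (is_derive_ext_loc (fun _ => 0)).
    + generalize (locally_lt 0 x H); apply filter_imp; intros y Hy; rewrite rpow_neg; lra.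
    + rewrite rpow_neg, Rmult_0_r by lra; apply @is_derive_const.
  - apply is_derive_Reals; intros eps He.
    destruct (rpow_small a eps Ha He) as (d & Hd & Hs).
    exists (mkposreal d Hd); intros h Hh Hhd; simpl in Hhd.
    rewrite (rpow_neg 0) by lra.
    (* The difference quotient at 0 is [rpow h a] itself, small for h > 0 and zero for h < 0. *)
    replace (((0 + h) * rpow (0 + h) a - 0 * 0) / h - (1 + a) * 0) with (rpow h a).
    + rewrite Rabs_pos_eq by apply rpow_ge0.
      apply Hs; apply Rabs_lt_between in Hhd; lra.
    + rewrite Rplus_0_l; field; exact Hh.
  - pose proof (rpow_is_derive_pos x a H) as D.
    auto_derive; [eexists; exact D|].
    replace (Derive _ x) with (a * rpow x a / x); [field; lra|].
    symmetry; apply is_derive_unique, D.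
Qed.

Lemma is_derive_Rplus (f g : R -> R) x df dg : is_derive f x df -> is_derive g x dg ->
  is_derive (fun y => f y + g y) x (df + dg).
Proof. exact (@is_derive_plus R_AbsRing R_NormedModule f g x df dg). Qed.

Lemma is_derive_Rminus (f g : R -> R) x df dg : is_derive f x df -> is_derive g x dg ->
  is_derive (fun y => f y - g y) x (df - dg).
Proof. exact (@is_derive_minus R_AbsRing R_NormedModule f g x df dg). Qed.

Lemma is_derive_Rmult (f g : R -> R) x df dg : is_derive f x df -> is_derive g x dg ->
  is_derive (fun y => f y * g y) x (df * g x + f x * dg).
Proof. intros Hf Hg; apply @is_derive_mult; [exact Hf|exact Hg|apply Rmult_comm]. Qed.

(** * Agreement of the notions of integral *)

Lemma has_RInt_of_is_RInt f a b I : is_RInt f a b I -> has_RInt f a b I.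
Proof.
  intros H; exists (ex_RInt_Reals_0 f a b (ex_intro _ I H)).
  rewrite <- RInt_Reals; now apply is_RInt_unique.
Qed.

Lemma has_RInt_unique f a b I : has_RInt f a b I -> RInt f a b = I.
Proof. intros (pr & E); now rewrite (RInt_Reals f a b pr). Qed.

Lemma Defs_RInt_unique f a b I : has_RInt f a b I -> Defs.RInt f a b = I.
Proof.
  intros H; unfold Defs.RInt.
  pose proof (ClassicalEpsilon.epsilon_spec (inhabits 0) (fun J => has_RInt f a b J)
    (ex_intro _ I H)) as E; cbv beta in E.
  now rewrite <- (has_RInt_unique _ _ _ _ E), (has_RInt_unique _ _ _ _ H).
Qed.

Lemma ImpInt01_unique f I : has_ImpInt01 f I -> ImpInt01 f = I.
Proof.
  intros H; unfold ImpInt01.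
  pose proof (ClassicalEpsilon.epsilon_spec (inhabits 0) (fun J => has_ImpInt01 f J)
    (ex_intro _ I H)) as E; cbv beta in E.
  refine (single_limit _ _ _ _ _ _ (proj2 E) (proj2 H)).
  (* A point of (0, 1) closer than [eps] to 1: uniqueness of the limit needs 1 to adhere to the
     domain. *)
  intros eps He; exists (1 - Rmin (1 / 2) (eps / 2)).
  assert (M := Rmin_l (1 / 2) (eps / 2)); assert (M' := Rmin_r (1 / 2) (eps / 2)).
  assert (0 < Rmin (1 / 2) (eps / 2)) by (apply Rmin_glb_lt; lra).
  split; [lra|]; unfold Rdist; rewrite Rabs_left; lra.
Qed.

(** [f] may be unbounded at 1; a primitive that is merely continuous there already yields the
    limit. *)
Lemma has_ImpInt01_of_primitive f H :
  (forall x, x < 1 -> is_derive H x (f x)) -> (forall x, x < 1 -> continuous f x) ->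
  continuous H 1 -> has_ImpInt01 f (H 1 - H 0).
Proof.
  intros D C C1.
  assert (I : forall u, 0 < u < 1 -> has_RInt f 0 u (H u - H 0)).
  { intros u Hu; apply has_RInt_of_is_RInt, (is_RInt_derive H f);
      rewrite Rmin_left, Rmax_right by lra; intros x Hx; [apply D|apply C]; lra. }
  split; [intros u Hu; eexists; now apply I|].
  apply continuity_pt_filterlim in C1.
  intros eps He; destruct (C1 eps He) as (d & Hd & Hc).
  exists d; split; [exact Hd|]; intros u [Hu Hud].
  rewrite (Defs_RInt_unique f 0 u _ (I u Hu)).
  assert (Hx : Rdist (H u) (H 1) < eps).
  { apply Hc; split; [split; [exact Logic.I|simpl in *; lra]|exact Hud]. }
  simpl; unfold Rdist in *; replace (H u - H 0 - (H 1 - H 0)) with (H u - H 1) by ring; exact Hx.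
Qed.

Lemma RInt_upper_is_derive (f : R -> R) a x : (forall y, continuous f y) ->
  is_derive (fun u => RInt f a u) x (f x).
Proof.
  intros C; apply (is_derive_RInt f (fun u => RInt f a u) a x); [|apply C].
  apply filter_forall; intros u; apply (RInt_correct f), ex_RInt_cont, C.
Qed.

(** * The generalized Jacobi weight *)

Section Weight.

Variables al be ga A B : R.
Hypotheses (Hal : 0 < al) (Hbe : 0 < be) (Hga : 0 < ga).

(** The factor |y|^ga (A + B theta(y)) split into its two sides. Since [ga] is positive, both parts
    vanish at 0 and the jump causes no discontinuity. *)
Definition jump_pow (y : R) : R := A * rpow (- y) ga + (A + B) * rpow y ga.
Definition jacobi (x : R) : R := rpow x al * rpow (1 - x) be.

Lemma weight_jump_pow t x : weight al be ga A B t x = jacobi x * jump_pow (x - t).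
Proof.
  unfold weight, jacobi, jump_pow, heaviside.
  destruct (Rlt_dec (x - t) 0) as [H|H].
  - rewrite (rpow_neg (x - t)) by lra; rewrite Rabs_left by lra; ring.
  - rewrite (rpow_neg (- (x - t))) by lra; rewrite Rabs_pos_eq by lra; ring.
Qed.

Lemma jump_pow_continuous y : continuous jump_pow y.
Proof.
  unfold jump_pow; repeat continuity_step.
  - apply (continuous_Rcomp (fun z => rpow z ga) (fun z => - z)); [repeat continuity_step|].
    now apply rpow_continuous.
  - now apply rpow_continuous.
Qed.

Lemma mul_jump_pow_is_derive y :
  is_derive (fun z => z * jump_pow z) y ((1 + ga) * jump_pow y).
Proof.
  apply (is_derive_ext (fun z => (- A) * ((- z) * rpow (- z) ga) + (A + B) * (z * rpow z ga)));
    [intros; unfold jump_pow; simpl; ring|].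
  pose proof (mul_rpow_is_derive ga y Hga) as D1.
  pose proof (mul_rpow_is_derive ga (- y) Hga) as D2.
  assert (D3 : is_derive (fun z => - z * rpow (- z) ga) y (-1 * ((1 + ga) * rpow (- y) ga))).
  { apply (is_derive_comp (fun z => z * rpow z ga) (fun z => - z) y); [exact D2|].
    auto_derive; [exact I|ring]. }
  evar_last.
  - apply @is_derive_plus; [apply is_derive_scal, D3|apply is_derive_scal, D1].
  - unfold jump_pow, plus; simpl; ring.
Qed.

Lemma jacobi_continuous x : continuous jacobi x.
Proof.
  unfold jacobi; continuity_step; [now apply rpow_continuous|].
  apply (continuous_Rcomp (fun z => rpow z be) (fun z => 1 - z)); [repeat continuity_step|].
  now apply rpow_continuous.
Qed.

Lemma jump_pow_shift_continuous t x : continuous (fun y => jump_pow (y - t)) x.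
Proof.
  apply (continuous_Rcomp jump_pow (fun y => y - t)); [repeat continuity_step|].
  apply jump_pow_continuous.
Qed.

Lemma weight_continuous t x : continuous (weight al be ga A B t) x.
Proof.
  apply (continuous_ext (fun x => jacobi x * jump_pow (x - t))).
  - intros; symmetry; apply weight_jump_pow.
  - continuity_step; [apply jacobi_continuous|apply jump_pow_shift_continuous].
Qed.

Lemma mul_jump_pow_shift_is_derive t x :
  is_derive (fun y => (y - t) * jump_pow (y - t)) x ((1 + ga) * jump_pow (x - t)).
Proof.
  rewrite <- (Rmult_1_l ((1 + ga) * _)).
  apply (is_derive_comp (fun z => z * jump_pow z) (fun y => y - t)).
  - apply mul_jump_pow_is_derive.
  - auto_derive; [exact I|ring].
Qed.

Lemma mul_rpow_compl_is_derive x :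
  is_derive (fun y => (1 - y) * rpow (1 - y) be) x (- ((1 + be) * rpow (1 - x) be)).
Proof.
  replace (- ((1 + be) * rpow (1 - x) be)) with (-1 * ((1 + be) * rpow (1 - x) be)) by ring.
  apply (is_derive_comp (fun z => z * rpow z be) (fun y => 1 - y)).
  - now apply mul_rpow_is_derive.
  - auto_derive; [exact I|ring].
Qed.

(* All three factors vanish together with their singularity, so the antiderivative is
   continuously differentiable on the whole line, endpoints and jump included. *)
Lemma weight_total_derive t g g' x : is_derive g x (g' x) ->
  is_derive (fun x => - (x * rpow x al * ((1 - x) * rpow (1 - x) be)
                         * ((x - t) * jump_pow (x - t)) * g x)) x
   ((x * (x - 1) * (x - t) * g' x
     + ((1 + al) * (x - 1) * (x - t) + (1 + be) * x * (x - t) + (1 + ga) * x * (x - 1)) * g x)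
    * weight al be ga A B t x).
Proof.
  intros Dg; rewrite weight_jump_pow.
  evar_last.
  - apply @is_derive_opp, is_derive_Rmult; [|exact Dg].
    apply is_derive_Rmult; [|apply mul_jump_pow_shift_is_derive].
    apply is_derive_Rmult; [now apply mul_rpow_is_derive|apply mul_rpow_compl_is_derive].
  - unfold opp, jacobi; simpl; ring.
Qed.

(** * The functional given by the weight *)

Definition wint (t : R) (f : R -> R) : R := RInt (fun x => f x * weight al be ga A B t x) 0 1.

Lemma poly_weight_continuous t n f x : is_poly n f ->
  continuous (fun x => f x * weight al be ga A B t x) x.
Proof.
  intros Hf; continuity_step; [now apply (poly_continuous n)|apply weight_continuous].
Qed.

Lemma wint_plus t n f g : is_poly n f -> is_poly n g ->
  wint t (fun x => f x + g x) = wint t f + wint t g.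
Proof.
  intros Hf Hg; unfold wint.
  rewrite (RInt_lin (fun x => f x * weight al be ga A B t x)
    (fun x => g x * weight al be ga A B t x) _ 0 1 1 1); [ring|..];
    try (intros; now apply (poly_weight_continuous t n)).
  intros; ring.
Qed.

Lemma wint_scal t n k f : is_poly n f -> wint t (fun x => k * f x) = k * wint t f.
Proof.
  intros Hf; unfold wint.
  rewrite (RInt_lin (fun x => f x * weight al be ga A B t x)
    (fun x => f x * weight al be ga A B t x) _ 0 1 k 0); [ring|..];
    try (intros; now apply (poly_weight_continuous t n)).
  intros; ring.
Qed.

Lemma wint_total_derivative t n g g' : is_poly n g -> is_poly n g' ->
  (forall x, is_derive g x (g' x)) ->
  wint t (fun x => x * (x - 1) * (x - t) * g' x
     + ((1 + al) * (x - 1) * (x - t) + (1 + be) * x * (x - t) + (1 + ga) * x * (x - 1)) * g x)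
  = 0.
Proof.
  intros Hg Hg' D; unfold wint.
  etransitivity; [apply (RInt_of_derive _ _ 0 1 (fun x => weight_total_derive t g g' x (D x)))|].
  - intros x.
    assert (continuous g x) by now apply (poly_continuous n).
    assert (continuous g' x) by now apply (poly_continuous n).
    continuity_step; [|apply weight_continuous].
    repeat continuity_step.
  - ring.
Qed.

(** The factor x - t absorbs the singularity of the t-derivative of the weight:
    [(x - t) * jump_pow (x - t)] has a continuous derivative in t, so differentiation under the
    integral applies. *)
Lemma wint_shift_is_derive n f t : is_poly n f ->
  is_derive (fun t => wint t (fun x => (x - t) * f x)) t (- (1 + ga) * wint t f).
Proof.
  intros Hf.
  set (phi := fun x => f x * jacobi x).
  assert (Cphi : forall x, continuous phi x).
  { intros x; unfold phi; continuity_step; [now apply (poly_continuous n)|apply jacobi_continuous]. }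
  apply (is_derive_ext (fun t => RInt (fun x => phi x * ((x - t) * jump_pow (x - t))) 0 1)).
  { intros s; unfold wint; apply RInt_ext; intros x _; rewrite weight_jump_pow; unfold phi.
    simpl; ring. }
  assert (D : forall s x, is_derive (fun u => phi x * ((x - u) * jump_pow (x - u))) s
     (- (1 + ga) * (phi x * jump_pow (x - s)))).
  { intros s x.
    replace (- (1 + ga) * (phi x * jump_pow (x - s)))
      with (phi x * (-1 * ((1 + ga) * jump_pow (x - s)))) by ring.
    apply is_derive_scal.
    apply (is_derive_comp (fun z => z * jump_pow z) (fun u => x - u)).
    - apply mul_jump_pow_is_derive.
    - auto_derive; [exact I|ring]. }
  evar_last.
  - apply (is_derive_RInt_param (fun s x => phi x * ((x - s) * jump_pow (x - s))) 0 1 t).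
    + apply filter_forall; intros s x _; eexists; apply D.
    + intros x _.
      apply (continuity_2d_pt_ext (fun u v => - (1 + ga) * (phi v * jump_pow (v - u)))).
      { intros u v; symmetry; apply is_derive_unique, D. }
      apply continuity_2d_pt_mult; [apply continuity_2d_pt_const|].
      apply continuity_2d_pt_mult.
      * apply (continuity_1d_2d_pt_comp phi (fun _ v => v)); [|apply continuity_2d_pt_id2].
        apply continuity_pt_filterlim, Cphi.
      * apply (continuity_1d_2d_pt_comp jump_pow (fun u v => v - u)).
        { apply continuity_pt_filterlim, jump_pow_continuous. }
        apply continuity_2d_pt_minus; [apply continuity_2d_pt_id2|apply continuity_2d_pt_id1].
    + apply filter_forall; intros s; apply ex_RInt_cont; intros x.
      continuity_step; [apply Cphi|].
      continuity_step; [repeat continuity_step|apply jump_pow_shift_continuous].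
  - unfold wint.
    rewrite (RInt_ext _ (fun x => - (1 + ga) * (phi x * jump_pow (x - t)) + 0 * phi x)).
    + rewrite (RInt_lin (fun x => f x * weight al be ga A B t x) phi _ 0 1 (- (1 + ga)) 0);
        [simpl; ring| |exact Cphi|].
      * intros x; now apply (poly_weight_continuous t n).
      * intros x; rewrite weight_jump_pow; unfold phi; ring.
    + intros x _; etransitivity; [exact (is_derive_unique _ _ _ (D t x))|simpl; ring].
Qed.

(** * Deformation of the first two moments *)

Notation m0 t := (wint t (fun _ => 1)).
Notation m1 t := (wint t (fun x => x)).

Lemma is_poly_X n : is_poly (S (S n)) (fun x => x).
Proof.
  apply (poly_ext _ (fun x => x * 1)); [intros; ring|]; apply poly_mulX, poly_const.
Qed.

Lemma wint_lin t n a b f g h : is_poly n f -> is_poly n g ->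
  (forall x, h x = a * f x + b * g x) -> wint t h = a * wint t f + b * wint t g.
Proof. apply L_lin; [apply wint_plus|apply wint_scal]. Qed.

(** [res_t], [res_1] and [res_0] are the integrals of w / (y - s) times the exponent at s, obtained
    by solving in turn the relations [e_moment1], [e_moment0] and [e_sum]. *)
Definition res_t (t : R) : R :=
  ((1 + al + ga * (1 - t)) * m0 t - (2 + al + be + ga) * m1 t) / (t * (t - 1)).
Definition res_1 (t : R) : R := - (1 + al + be + ga) * m0 t - t * res_t t.
Definition res_0 (t : R) : R := - res_1 t - res_t t.

(** Only M1 = m1 - t m0 and M2 = m2 - t m1 can be differentiated under the integral. The total
    derivative with g = 1 gives a third relation among m0, m1 and m2; solving for m1 and then m0
    divides by 1 - t and by t. *)
Lemma moments_is_derive t : 0 < t < 1 ->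
  is_derive (fun t => m0 t) t (- res_t t) /\
  is_derive (fun t => m1 t) t (((1 + al) * m0 t - (2 + al + be + ga) * m1 t) / (1 - t)).
Proof.
  intros Ht.
  set (M1 := fun t => wint t (fun x => (x - t) * 1)).
  set (M2 := fun t => wint t (fun x => (x - t) * x)).
  assert (D1 : is_derive M1 t (- (1 + ga) * m0 t)).
  { apply (wint_shift_is_derive 1), poly_const. }
  assert (D2 : is_derive M2 t (- (1 + ga) * m1 t)).
  { apply (wint_shift_is_derive 2), is_poly_X. }
  set (m2 := fun t => wint t (fun x => x * x)).
  assert (PX2 : is_poly 3 (fun x => x * x)) by apply poly_mulX, is_poly_X.
  assert (E1 : forall s, M1 s = m1 s - s * m0 s).
  { intros s; unfold M1; rewrite (wint_lin s 2 1 (- s) (fun x => x) (fun _ => 1));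
      [ring|apply is_poly_X|apply poly_const|intros; ring]. }
  assert (E2 : forall s, M2 s = m2 s - s * m1 s).
  { intros s; unfold M2; rewrite (wint_lin s 3 1 (- s) (fun x => x * x) (fun x => x));
      [unfold m2; ring|exact PX2|apply is_poly_X|intros; ring]. }
  assert (Rel : forall s, (1 + ga) * (m1 s - m2 s)
     = - (1 + al) * M1 s + (2 + al + be) * M2 s).
  { intros s; rewrite E1, E2.
    assert (T := wint_total_derivative s 1 (fun _ => 1) (fun _ => 0) (poly_const _ _)
      (poly_zero _) (fun x => is_derive_const 1 x)).
    rewrite (wint_lin s 3 (3 + al + be + ga) 1 (fun x => x * x)
      (fun x => - ((1 + al) * (1 + s) + (1 + be) * s + (1 + ga)) * x + (1 + al) * s * 1)) in T;
      [|exact PX2|apply poly_add; apply poly_scal; [apply is_poly_X|apply poly_const]|intros; ring].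
    rewrite (wint_lin s 3 (- ((1 + al) * (1 + s) + (1 + be) * s + (1 + ga))) ((1 + al) * s)
      (fun x => x) (fun _ => 1) (fun x =>
      - ((1 + al) * (1 + s) + (1 + be) * s + (1 + ga)) * x + (1 + al) * s * 1)) in T; [|apply is_poly_X|apply poly_const|intros; ring].
    fold (m2 s) in T; lra. }
  assert (F1 : forall s, 0 < s < 1 -> m1 s
     = (- (1 + al) * M1 s + (3 + al + be + ga) * M2 s) / ((1 + ga) * (1 - s))).
  { intros s Hs; apply (Rmult_eq_reg_r ((1 + ga) * (1 - s))); [|nra].
    unfold Rdiv; rewrite Rmult_assoc, Rinv_l by nra.
    pose proof (Rel s) as Q; rewrite !E1, !E2 in *; lra. }
  assert (F0 : forall s, 0 < s < 1 -> m0 s = (m1 s - M1 s) / s).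
  { intros s Hs; rewrite E1; field; lra. }
  assert (Loc : locally t (fun s => 0 < s < 1)).
  { apply filter_and; [now apply locally_gt|now apply locally_lt]. }
  assert (Dm1 : is_derive (fun t => m1 t) t
    (((1 + al) * m0 t - (2 + al + be + ga) * m1 t) / (1 - t))).
  { apply (is_derive_ext_loc
      (fun s => (- (1 + al) * M1 s + (3 + al + be + ga) * M2 s) / ((1 + ga) * (1 - s)))).
    - revert Loc; apply filter_imp; intros s Hs; symmetry; now apply F1.
    - assert (V : - (1 + al) * M1 t + (3 + al + be + ga) * M2 t = m1 t * ((1 + ga) * (1 - t))).
      { rewrite (F1 t Ht); field; nra. }
      auto_derive.
      + repeat split; [eexists; exact D1|eexists; exact D2|nra].
      + replace (Derive _ t) with (- (1 + ga) * m0 t) by (symmetry; apply is_derive_unique, D1).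
        replace (Derive _ t) with (- (1 + ga) * m1 t) by (symmetry; apply is_derive_unique, D2).
        unfold Rminus in V; rewrite V; field; lra. }
  split; [|exact Dm1].
  apply (is_derive_ext_loc (fun s => (m1 s - M1 s) / s)).
  - revert Loc; apply filter_imp; intros s Hs; symmetry; now apply F0.
  - evar_last.
    + apply is_derive_div; [apply @is_derive_minus; [exact Dm1|exact D1]|apply @is_derive_id|lra].
    + unfold minus, plus, opp, one; simpl; rewrite E1; unfold res_t; field; lra.
Qed.

Lemma res_t_spec t : 0 < t < 1 -> t * (t - 1) * res_t t
  = (1 + al + ga * (1 - t)) * m0 t - (2 + al + be + ga) * m1 t.
Proof. intros Ht; unfold res_t; field; lra. Qed.

Lemma res_t_is_derive t : 0 < t < 1 -> is_derive res_t t
  (((al + be + ga) * res_t t - (be * res_t t - ga * res_1 t) / (1 - t)) / t).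
Proof.
  intros Ht; destruct (moments_is_derive t Ht) as [D0 D1].
  (* Abstract functions with the same values and derivatives replace the moments, so that
     [auto_derive] does not enter the integrals. *)
  assert (G : forall f g : R -> R, is_derive f t (- res_t t) ->
    is_derive g t (((1 + al) * m0 t - (2 + al + be + ga) * m1 t) / (1 - t)) ->
    f t = m0 t -> g t = m1 t ->
    is_derive (fun t => ((1 + al + ga * (1 - t)) * f t - (2 + al + be + ga) * g t) / (t * (t - 1)))
      t (((al + be + ga) * res_t t - (be * res_t t - ga * res_1 t) / (1 - t)) / t)).
  { intros f g Df Dg Ef Eg; auto_derive.
    - repeat split; first [eexists; exact Df|eexists; exact Dg|nra].
    - replace (Derive _ t) with (- res_t t) by (symmetry; apply is_derive_unique, Df).
      replace (Derive _ t) with (((1 + al) * m0 t - (2 + al + be + ga) * m1 t) / (1 - t))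
        by (symmetry; apply is_derive_unique, Dg).
      rewrite Ef, Eg; unfold res_1, res_t; field; lra. }
  exact (G (fun t => m0 t) (fun t => m1 t) D0 D1 eq_refl eq_refl).
Qed.

(** Together with [res_0_is_derive], this is the degree-0 case of the equation for [u] in
    [deforms]. *)
Lemma res_1_is_derive t : 0 < t < 1 ->
  is_derive res_1 t ((be * res_t t - ga * res_1 t) / (1 - t)).
Proof.
  intros Ht; destruct (moments_is_derive t Ht) as [D0 _].
  evar_last.
  - apply (@is_derive_minus R_AbsRing R_NormedModule); [apply is_derive_scal, D0|].
    apply is_derive_Rmult; [apply @is_derive_id|now apply res_t_is_derive].
  - unfold minus, plus, opp, one; simpl; field; lra.
Qed.

Lemma res_0_is_derive t : 0 < t < 1 ->
  is_derive res_0 t ((al * res_t t - ga * res_0 t) / (0 - t)).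
Proof.
  intros Ht; evar_last.
  - apply (@is_derive_minus R_AbsRing R_NormedModule);
      [apply @is_derive_opp; now apply res_1_is_derive|now apply res_t_is_derive].
  - unfold minus, plus, opp, res_0; simpl; field; lra.
Qed.

(** Writing f = f(1) + (y - 1) g isolates the singular part f(1) w / (1 - y). Up to a regular
    multiple of w, that part is the derivative of [- c * b], which is continuous at 1 because [be]
    is positive. *)
Lemma ImpInt01_weight t n f : 0 < t < 1 -> is_poly n f ->
  ImpInt01 (fun y => f y * weight al be ga A B t y / (1 - y))
  = - pole_functional (wint t) 1 be (res_1 t) f / be.
Proof.
  intros Ht Hf.
  destruct (poly_factor n 1 f (poly_S _ _ Hf)) as (g & Hg & F).
  (* Differentiating (1 - x)^be in [b] produces be x (x - t) w / (1 - x) with a minus sign. The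
     identity x (x - t) = (1 - t) - (1 - x) (x + 1 - t) separates its singular part: [c] normalizes
     that part to f(1), and [l] collects the regular terms. *)
  set (c := f 1 / (be * (1 - t))).
  set (l := fun y => (1 + al) * (y - t) + (1 + ga) * y + be * (y + 1 - t)).
  set (k := fun y => c * l y - g y).
  assert (Hl : is_poly (S (S n)) l).
  { apply (poly_ext _ (fun y => (2 + al + be + ga) * y + (be * (1 - t) - (1 + al) * t) * 1));
      [intros; unfold l; ring|].
    apply poly_add; apply poly_scal; [apply is_poly_X|apply poly_const]. }
  assert (Hg' : is_poly (S (S n)) g) by now apply poly_S, poly_S.
  assert (Hk : is_poly (S (S n)) k) by (apply poly_sub; [now apply poly_scal|exact Hg']).
  set (b := fun u => u * rpow u al * ((u - t) * jump_pow (u - t)) * rpow (1 - u) be).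
  set (K := fun u : R => RInt (fun x => k x * weight al be ga A B t x) 0 u : R).
  set (H := fun u => - c * b u + K u).
  assert (DK : forall x, is_derive K x (k x * weight al be ga A B t x)).
  { intros x; apply (RInt_upper_is_derive (fun x => k x * weight al be ga A B t x)); intros y; now apply (poly_weight_continuous t (S (S n))). }
  assert (DU : forall x, is_derive (fun u => u * rpow u al * ((u - t) * jump_pow (u - t))) x
     (((1 + al) * (x - t) + (1 + ga) * x) * (rpow x al * jump_pow (x - t)))).
  { intros x; evar_last.
    - apply is_derive_Rmult; [now apply mul_rpow_is_derive|apply mul_jump_pow_shift_is_derive].
    - simpl; ring. }
  replace (- pole_functional (wint t) 1 be (res_1 t) f / be) with (H 1 - H 0).
  - apply ImpInt01_unique, has_ImpInt01_of_primitive.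
    + intros x Hx.
      assert (Dr : is_derive (fun u => rpow (1 - u) be) x (-1 * (be * rpow (1 - x) be / (1 - x)))).
      { apply (is_derive_comp (fun z => rpow z be) (fun u => 1 - u)).
        - apply rpow_is_derive_pos; lra.
        - auto_derive; [exact I|ring]. }
      unfold H; evar_last.
      * apply @is_derive_plus; [apply is_derive_scal, is_derive_Rmult; [apply DU|apply Dr]|apply DK].
      * rewrite weight_jump_pow, F; unfold plus, k, l, c, jacobi; simpl; field; lra.
    + intros x Hx; unfold Rdiv; continuity_step; [now apply (poly_weight_continuous t n)|].
      apply @ex_derive_continuous; auto_derive; lra.
    + unfold H; continuity_step.
      * continuity_step; [apply continuous_const|]; unfold b; continuity_step.
        -- apply @ex_derive_continuous; eexists; apply DU.
        -- apply (continuous_Rcomp (fun z => rpow z be) (fun z => 1 - z)); [repeat continuity_step|].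
           now apply rpow_continuous.
      * apply @ex_derive_continuous; eexists; apply DK.
  - unfold H.
    assert (B1 : b 1 = 0) by (unfold b; rewrite (rpow_neg (1 - 1)) by lra; ring).
    assert (B0 : b 0 = 0) by (unfold b; ring).
    assert (K0 : K 0 = 0) by (unfold K; rewrite RInt_point; reflexivity).
    assert (K1 : K 1 = c * wint t l - wint t g).
    { unfold K; fold (wint t k).
      rewrite (wint_lin t (S (S n)) c (-1) l g); auto; [ring|intros; unfold k; ring]. }
    rewrite B1, B0, K0, K1.
    rewrite (pole_factor (wint t) 1 be (res_1 t) n (f 1) f g Hg F).
    rewrite (wint_lin t (S (S n)) (2 + al + be + ga) (be * (1 - t) - (1 + al) * t)
      (fun x => x) (fun _ => 1) l); [|apply is_poly_X|apply poly_const|intros; unfold l; ring].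
    unfold c, res_1, res_t; field; lra.
Qed.

(** * Positivity of the squared norms *)

Hypotheses (HA : 0 <= A) (HAB : 0 <= A + B) (Hne : ~ (A = 0 /\ A + B = 0)).

Lemma weight_ge0 t x : 0 <= weight al be ga A B t x.
Proof.
  rewrite weight_jump_pow; unfold jacobi, jump_pow.
  apply Rmult_le_pos; [apply Rmult_le_pos; apply rpow_ge0|].
  apply Rplus_le_le_0_compat; apply Rmult_le_pos; auto using rpow_ge0.
Qed.

(** If [A = 0] or [A + B = 0], the weight vanishes on a whole side of [t]; the interval is taken on
    a side where it does not. *)
Lemma weight_gt0_interval t : 0 < t < 1 ->
  exists a b, 0 <= a /\ a < b /\ b <= 1 /\ forall x, a < x < b -> 0 < weight al be ga A B t x.
Proof.
  intros Ht.
  assert (J : forall x, 0 < x < 1 -> 0 < jacobi x).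
  { intros x Hx; apply Rmult_lt_0_compat; apply rpow_gt0; lra. }
  destruct (Rle_lt_or_eq_dec 0 A HA) as [HA0|HA0].
  - exists 0, t; repeat split; try lra; intros x Hx; rewrite weight_jump_pow.
    apply Rmult_lt_0_compat; [apply J; lra|]; unfold jump_pow.
    assert (0 < rpow (- (x - t)) ga) by (apply rpow_gt0; lra).
    pose proof (rpow_ge0 (x - t) ga); nra.
  - assert (0 < A + B) by (destruct (Rle_lt_or_eq_dec _ _ HAB); [lra|destruct Hne; lra]).
    exists t, 1; repeat split; try lra; intros x Hx; rewrite weight_jump_pow.
    apply Rmult_lt_0_compat; [apply J; lra|]; unfold jump_pow.
    assert (0 < rpow (x - t) ga) by (apply rpow_gt0; lra).
    pose proof (rpow_ge0 (- (x - t)) ga); nra.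
Qed.

(** A monic polynomial cannot vanish on the whole interval of positivity, so f^2 w is positive
    around some [x0] in it, and the rest of [0, 1] contributes nonnegatively. *)
Lemma wint_sq_monic t n f : 0 < t < 1 -> monic n f -> wint t (fun x => f x * f x) <> 0.
Proof.
  intros Ht Hf Z.
  assert (Pf : is_poly (S n) f) by now apply monic_poly.
  destruct (weight_gt0_interval t Ht) as (a & b & Ha & Hab & Hb & Hw).
  assert (Hz : exists x, a < x < b /\ f x <> 0).
  { destruct (Classical_Prop.classic (exists x, a < x < b /\ f x <> 0)) as [H|H]; [exact H|].
    exfalso; apply (monic_not_zero n f Hf), (poly_zero_on_interval (S n) f a b Pf Hab).
    intros x Hx; destruct (Req_dec (f x) 0) as [E|E]; [exact E|].
    exfalso; apply H; now exists x. }
  destruct Hz as (x0 & Hx0 & Fx0).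
  set (F := fun x => f x * f x * weight al be ga A B t x).
  assert (CF : forall x, continuous F x).
  { intros x; apply (poly_weight_continuous t (S n + S n) (fun x => f x * f x)).
    now apply poly_mul. }
  assert (F0 : forall x, 0 <= F x).
  { intros x; apply Rmult_le_pos; [apply Rle_0_sqr|apply weight_ge0]. }
  assert (Cf : continuous f x0) by now apply (poly_continuous (S n)).
  assert (Loc : locally x0 (fun x => f x <> 0)).
  { apply (Cf (fun y => y <> 0)).
    exists (mkposreal (Rabs (f x0)) (Rabs_pos_lt _ Fx0)); intros y Hy E.
    apply Rabs_def2 in Hy; unfold minus, plus, opp in Hy; simpl in Hy; rewrite E in Hy.
    destruct (Rcase_abs (f x0)); [rewrite Rabs_left in Hy|rewrite Rabs_right in Hy]; lra. }
  destruct Loc as (d & Hd).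
  set (r := Rmin d (Rmin (x0 - a) (b - x0)) / 2).
  assert (Hr : 0 < r /\ r < d /\ a < x0 - r /\ x0 + r < b).
  { destruct d as [d' Hd']; simpl in *.
    unfold r; pose proof (Rmin_l d' (Rmin (x0 - a) (b - x0))).
    pose proof (Rmin_r d' (Rmin (x0 - a) (b - x0))).
    pose proof (Rmin_l (x0 - a) (b - x0)); pose proof (Rmin_r (x0 - a) (b - x0)).
    assert (0 < Rmin d' (Rmin (x0 - a) (b - x0))) by (repeat apply Rmin_glb_lt; lra).
    lra. }
  assert (Pos : 0 < RInt F (x0 - r) (x0 + r)).
  { apply RInt_gt_0; [lra| |auto].
    intros x Hx; apply Rmult_lt_0_compat; [|apply Hw; lra].
    apply Rsqr_pos_lt, Hd.
    apply Rabs_def1; unfold minus, plus, opp; simpl; lra. }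
  assert (I1 : 0 <= RInt F 0 (x0 - r)).
  { apply RInt_ge_0; [lra|now apply ex_RInt_cont|auto]. }
  assert (I2 : 0 <= RInt F (x0 + r) 1).
  { apply RInt_ge_0; [lra|now apply ex_RInt_cont|auto]. }
  assert (Ch : RInt F 0 1 = RInt F 0 (x0 - r) + RInt F (x0 - r) (x0 + r) + RInt F (x0 + r) 1).
  { rewrite <- (RInt_Chasles F 0 (x0 - r) 1), <- (RInt_Chasles F (x0 - r) (x0 + r) 1);
      try now apply ex_RInt_cont.
    unfold plus; simpl; ring. }
  unfold wint in Z; fold F in Z; lra.
Qed.

End Weight.

(** * Deformation in t and the Painleve equation *)

Inductive pole := pole0 | pole1 | polet.

Definition location (i : pole) (t : R) : R :=
  match i with pole0 => 0 | pole1 => 1 | polet => t end.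

(** The known value [z] of the quotient replaces it in the derivative, leaving a relation without
    division by [y]. *)
Lemma quotient_rule_eq (x x' y y' z r : R) : y <> 0 -> x = z * y -> x' = y' * z + y * r ->
  (x' * y - x * y') / y ^ 2 = r.
Proof. intros Hy -> ->; field; exact Hy. Qed.

Ltac derive_subst :=
  repeat match goal with
  | H : is_derive ?f ?t ?d |- context [Derive ?g ?t] =>
      replace (Derive g t) with d by (symmetry; exact (is_derive_unique f t d H))
  end.

(** At each pole s, [a], [b] and [g] stand for p u, q v and p v + q u, and [N] for 2n + 1 + al + be
    + ga. *)
Definition pvi_S (N t h a1 : R) : R := 1 - (t - 1) * a1 / (N * h).

(** The derivative of [pvi_S] along the Schlesinger flow, with h' = - a_t. The pole t is eliminated
    by sum a = sum b = 0 and sum g = 1 - N; [pvi_S''] is one more derivative. *)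
Definition pvi_S' (N t h a0 a1 g0 g1 : R) : R :=
  let at_ := - a0 - a1 in let gt := 1 - N - g0 - g1 in
  (- a1 + (a1 * gt - at_ * g1)) / (N * h) - (t - 1) * a1 * at_ / (N * h ^ 2).

Definition pvi_S'' (N t h a0 a1 g0 g1 b0 b1 : R) : R :=
  let at_ := - a0 - a1 in let gt := 1 - N - g0 - g1 in let bt := - b0 - b1 in
  let a0' := (a0 * gt - at_ * g0) / (0 - t) in
  let a1' := (a1 * gt - at_ * g1) / (1 - t) in
  let at' := - a0' - a1' in
  let g0' := 2 * ((a0 * bt - at_ * b0) / (0 - t)) in
  let g1' := 2 * ((a1 * bt - at_ * b1) / (1 - t)) in
  let gt' := - g0' - g1' in
  (- a1' + (a1' * gt + a1 * gt' - at' * g1 - at_ * g1')) / (N * h)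
  + at_ * (- a1 + (a1 * gt - at_ * g1)) / (N * h ^ 2)
  - (a1 * at_ + (t - 1) * (a1' * at_ + a1 * at')) / (N * h ^ 2)
  - 2 * at_ * (t - 1) * a1 * at_ / (N * h ^ 3).

(* [g_s^2 - 4 a_s b_s = (p v - q u)^2] is the squared exponent at [s]; with the exponents
   eliminated in this way the equation is an identity of rational functions. *)
Lemma pvi_identity (N t h a0 a1 g0 g1 b0 b1 : R) :
  let at_ := - a0 - a1 in let gt := 1 - N - g0 - g1 in let bt := - b0 - b1 in
  let S := pvi_S N t h a1 in
  0 < t < 1 -> N <> 0 -> h <> 0 -> a1 + t * at_ = - N * h ->
  S <> 0 -> S <> 1 -> S <> t ->
  pvi_S'' N t h a0 a1 g0 g1 b0 b1
  = PVI_rhs (N ^ 2 / 2) (- ((g0 ^ 2 - 4 * a0 * b0) / 2)) ((g1 ^ 2 - 4 * a1 * b1) / 2)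
      ((1 - (gt ^ 2 - 4 * at_ * bt)) / 2) t S (pvi_S' N t h a0 a1 g0 g1).
Proof.
  intros at_ gt bt S Ht HN Hh E HS0 HS1 HSt.
  assert (Hq : a1 + t * at_ <> 0) by (rewrite E; apply Rmult_integral_contrapositive; split; lra).
  assert (Eh : h = - (a1 + t * at_) / N) by (rewrite E; field; exact HN).
  (* Once [h] is eliminated by [E], S - s is proportional to the number a_s at each pole s. The
     three conditions on [S] thus make a0, a1 and a_t nonzero, as the denominators require. *)
  assert (E0 : S = - a0 * t / (a1 + t * at_)).
  { unfold S, pvi_S; rewrite Eh; unfold at_ in *; field; auto. }
  assert (E1 : S - 1 = (t - 1) * a1 / (a1 + t * at_)).
  { unfold S, pvi_S; rewrite Eh; unfold at_ in *; field; auto. }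
  assert (Et : S - t = - t * (t - 1) * at_ / (a1 + t * at_)).
  { unfold S, pvi_S; rewrite Eh; unfold at_ in *; field; auto. }
  assert (Ha0 : a0 <> 0).
  { intros Z; apply HS0; rewrite E0, Z; unfold Rdiv; ring. }
  assert (Ha1 : a1 <> 0).
  { intros Z; apply HS1, Rminus_diag_uniq; rewrite E1, Z; unfold Rdiv; ring. }
  assert (Hat : at_ <> 0).
  { intros Z; apply HSt, Rminus_diag_uniq; rewrite Et, Z; unfold Rdiv; ring. }
  unfold PVI_rhs; rewrite Et, E1, E0.
  unfold pvi_S'', pvi_S'; cbv zeta; fold at_ gt bt; rewrite Eh.
  unfold gt, bt, at_ in *.
  field; repeat split; lra || auto.
Qed.

Lemma pvi_S_is_derive (N t : R) (h a1 : R -> R) (a0 g0 g1 : R) :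
  0 < t < 1 -> N <> 0 -> h t <> 0 -> is_derive h t (- (- a0 - a1 t)) ->
  is_derive a1 t ((a1 t * (1 - N - g0 - g1) - (- a0 - a1 t) * g1) / (1 - t)) ->
  is_derive (fun t => pvi_S N t (h t) (a1 t)) t (pvi_S' N t (h t) a0 (a1 t) g0 g1).
Proof.
  intros Ht HN Hh Dh D1; unfold pvi_S, pvi_S'; cbv zeta.
  auto_derive.
  - repeat split; try (eexists; eassumption).
    apply Rmult_integral_contrapositive; auto.
  - derive_subst; field; repeat split; lra || auto.
Qed.

Lemma pvi_S'_is_derive (N t : R) (h a0 a1 g0 g1 : R -> R) (b0 b1 : R) :
  0 < t < 1 -> N <> 0 -> h t <> 0 -> is_derive h t (- (- a0 t - a1 t)) ->
  is_derive a0 t ((a0 t * (1 - N - g0 t - g1 t) - (- a0 t - a1 t) * g0 t) / (0 - t)) ->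
  is_derive a1 t ((a1 t * (1 - N - g0 t - g1 t) - (- a0 t - a1 t) * g1 t) / (1 - t)) ->
  is_derive g0 t (2 * ((a0 t * (- b0 - b1) - (- a0 t - a1 t) * b0) / (0 - t))) ->
  is_derive g1 t (2 * ((a1 t * (- b0 - b1) - (- a0 t - a1 t) * b1) / (1 - t))) ->
  is_derive (fun t => pvi_S' N t (h t) (a0 t) (a1 t) (g0 t) (g1 t)) t
    (pvi_S'' N t (h t) (a0 t) (a1 t) (g0 t) (g1 t) b0 b1).
Proof.
  intros Ht HN Hh Dh Da0 Da1 Dg0 Dg1; unfold pvi_S', pvi_S''; cbv zeta.
  auto_derive.
  - repeat split; try (eexists; eassumption);
      repeat apply Rmult_integral_contrapositive_currified; lra || auto.
  - derive_subst; field; repeat split; lra || auto.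
Qed.

(** * Schlesinger equations by induction on the degree *)

Section Schlesinger.

(* [p] and [u] stand for [P_n(s)] and [kap_s int P_n w / (y - s)] at the pole [s], [q] and [v]
   for the same with [P_(n-1) / h_(n-1)]; [a] and [h] are the diagonal recurrence coefficient
   and the squared norm. *)
Variable kap : pole -> R.
Notation sig := (kap pole0 + kap pole1 + kap polet).
Variables p q u v : pole -> nat -> R -> R.
Variables h a : nat -> R -> R.

Notation I01 t := (0 < t < 1).
Hypothesis h_neq0 : forall n t, I01 t -> h n t <> 0.
Hypothesis p_S : forall i n t, I01 t ->
  p i (S n) t = (location i t - a n t) * p i n t - h n t * q i n t.
Hypothesis u_S : forall i n t, I01 t ->
  u i (S n) t = (location i t - a n t) * u i n t - h n t * v i n t.
Hypothesis q_S : forall i n t, I01 t -> q i (S n) t = p i n t / h n t.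
Hypothesis v_S : forall i n t, I01 t -> v i (S n) t = u i n t / h n t.
Hypothesis p_0 : forall i t, I01 t -> p i O t = 1.
Hypothesis q_0 : forall i t, I01 t -> q i O t = 0.
Hypothesis v_0 : forall i t, I01 t -> v i O t = - kap i.
Hypothesis sum_pu : forall n t, I01 t ->
  p pole0 n t * u pole0 n t + p pole1 n t * u pole1 n t + p polet n t * u polet n t = 0.
Hypothesis moment_pu : forall n t, I01 t ->
  p pole1 n t * u pole1 n t + t * (p polet n t * u polet n t)
  = - (2 * INR n + 1 + sig) * h n t.
Hypothesis sig_gt0 : 0 < sig.
Hypothesis u_0_is_derive : forall i t, I01 t -> i <> polet ->
  is_derive (u i O) t ((kap i * u polet O t - kap polet * u i O t) / (location i t - t)).
Hypothesis h_0_is_derive : forall t, I01 t -> is_derive (h O) t (- u polet O t).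

(** Both (p, q) and (u, v) are multiplied by the matrix with rows (s - a, - h) and (1/h, 0), of
    determinant 1. *)
Lemma det_pv_qu i n t : I01 t -> p i n t * v i n t - q i n t * u i n t = - kap i.
Proof.
  intros Ht; induction n as [|n IH].
  - rewrite p_0, q_0, v_0 by exact Ht; ring.
  - rewrite p_S, q_S, u_S, v_S by exact Ht; rewrite <- IH; field; now apply h_neq0.
Qed.

(** At degree n + 1, q u equals (s - a) p u / h - p v. The first term sums by [moment_pu] and
    [sum_pu]; in the second, [det_pv_qu] replaces p v by q u - kap. *)
Lemma sum_qu n t : I01 t ->
  q pole0 n t * u pole0 n t + q pole1 n t * u pole1 n t + q polet n t * u polet n t = - INR n.
Proof.
  intros Ht; induction n as [|n IH].
  - rewrite !q_0 by exact Ht; simpl; ring.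
  - rewrite !q_S, !u_S by exact Ht; rewrite S_INR.
    pose proof (h_neq0 n t Ht) as Hh.
    apply (Rmult_eq_reg_r (h n t)); [|exact Hh].
    pose proof (sum_pu n t Ht) as E1; pose proof (moment_pu n t Ht) as E2.
    pose proof (det_pv_qu pole0 n t Ht) as F0; pose proof (det_pv_qu pole1 n t Ht) as F1.
    pose proof (det_pv_qu polet n t Ht) as F2.
    transitivity (p pole1 n t * u pole1 n t + t * (p polet n t * u polet n t)
      - a n t * (p pole0 n t * u pole0 n t + p pole1 n t * u pole1 n t + p polet n t * u polet n t)
      - h n t * ((p pole0 n t * v pole0 n t - q pole0 n t * u pole0 n t)
         + (p pole1 n t * v pole1 n t - q pole1 n t * u pole1 n t)
         + (p polet n t * v polet n t - q polet n t * u polet n t)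
         + (q pole0 n t * u pole0 n t + q pole1 n t * u pole1 n t + q polet n t * u polet n t))).
    + simpl location; field; exact Hh.
    + rewrite E1, E2, F0, F1, F2, IH; ring.
Qed.

Lemma sum_qv n t : I01 t ->
  q pole0 n t * v pole0 n t + q pole1 n t * v pole1 n t + q polet n t * v polet n t = 0.
Proof.
  intros Ht; destruct n as [|n].
  - rewrite !q_0 by exact Ht; ring.
  - rewrite !q_S, !v_S by exact Ht.
    transitivity ((p pole0 n t * u pole0 n t + p pole1 n t * u pole1 n t
      + p polet n t * u polet n t) / h n t ^ 2).
    + field; now apply h_neq0.
    + rewrite sum_pu by exact Ht; field; now apply h_neq0.
Qed.

Notation g i n t := (p i n t * v i n t + q i n t * u i n t).

Lemma sum_g n t : I01 t -> g pole0 n t + g pole1 n t + g polet n t = - (2 * INR n + sig).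
Proof.
  intros Ht; pose proof (sum_qu n t Ht) as E.
  pose proof (det_pv_qu pole0 n t Ht); pose proof (det_pv_qu pole1 n t Ht).
  pose proof (det_pv_qu polet n t Ht); lra.
Qed.

(** [sum_pu] at degree n + 1 is quadratic in [a n t], but the coefficient of the square is [sum_pu]
    at degree n, hence 0. The remaining linear equation determines [a n t]. *)
Lemma diag_coef_eq n t : I01 t ->
  a n t * (h n t * (2 * INR n + 2 + sig))
  = h n t * (g pole1 n t + t * g polet n t)
    - (p pole1 n t * u pole1 n t + t * t * (p polet n t * u polet n t)).
Proof.
  intros Ht; pose proof (sum_pu (S n) t Ht) as E.
  rewrite !p_S, !u_S in E by exact Ht; simpl location in E.
  pose proof (sum_pu n t Ht) as E1; pose proof (moment_pu n t Ht) as E2.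
  pose proof (sum_g n t Ht) as E3.
  assert (E' : (p pole1 n t * u pole1 n t + t * t * (p polet n t * u polet n t))
     - 2 * a n t * (p pole1 n t * u pole1 n t + t * (p polet n t * u polet n t))
     + a n t * a n t * (p pole0 n t * u pole0 n t + p pole1 n t * u pole1 n t
         + p polet n t * u polet n t)
     - h n t * (g pole1 n t + t * g polet n t)
     + a n t * h n t * (g pole0 n t + g pole1 n t + g polet n t)
     + h n t * h n t * (q pole0 n t * v pole0 n t + q pole1 n t * v pole1 n t
         + q polet n t * v polet n t) = 0) by (rewrite <- E; ring).
  rewrite E1, E2, E3, (sum_qv n t Ht) in E'; lra.
Qed.

(** At a fixed pole s, (p, q) obeys a linear equation whose matrix is a rank-one residue of trace
    kap_t divided by s - t. The extra - kap_t for (u, v) compensates this trace and keeps p v - q u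
    constant. *)
Definition deforms (n : nat) : Prop :=
  (forall t, I01 t -> is_derive (h n) t (- (p polet n t * u polet n t))) /\
  (forall i t, I01 t -> i <> polet ->
    is_derive (p i n) t (u polet n t * (p i n t * q polet n t - q i n t * p polet n t)
      / (location i t - t)) /\
    is_derive (q i n) t (v polet n t * (p i n t * q polet n t - q i n t * p polet n t)
      / (location i t - t)) /\
    is_derive (u i n) t ((u polet n t * (u i n t * q polet n t - v i n t * p polet n t)
      - kap polet * u i n t) / (location i t - t)) /\
    is_derive (v i n) t ((v polet n t * (u i n t * q polet n t - v i n t * p polet n t)
      - kap polet * v i n t) / (location i t - t))).

Lemma location_neq i t : I01 t -> i <> polet -> location i t - t <> 0.
Proof. destruct i; simpl; intros; [lra|lra|congruence]. Qed.

Lemma pu_is_derive n i t : deforms n -> I01 t -> i <> polet ->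
  is_derive (fun t => p i n t * u i n t) t
    ((p i n t * u i n t * g polet n t - p polet n t * u polet n t * g i n t) / (location i t - t)).
Proof.
  intros [_ D] Ht Hi; destruct (D i t Ht Hi) as (Dp & _ & Du & _).
  evar_last; [apply is_derive_Rmult; [exact Dp|exact Du]|].
  pose proof (det_pv_qu polet n t Ht) as F.
  assert (K : kap polet = q polet n t * u polet n t - p polet n t * v polet n t) by lra.
  rewrite K; simpl; field; now apply location_neq.
Qed.

Lemma qu_is_derive n i t : deforms n -> I01 t -> i <> polet ->
  is_derive (fun t => q i n t * u i n t) t
    ((p i n t * u i n t * (q polet n t * v polet n t)
      - p polet n t * u polet n t * (q i n t * v i n t)) / (location i t - t)).
Proof.
  intros [_ D] Ht Hi; destruct (D i t Ht Hi) as (_ & Dq & Du & _).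
  evar_last; [apply is_derive_Rmult; [exact Dq|exact Du]|].
  pose proof (det_pv_qu polet n t Ht) as F.
  assert (K : kap polet = q polet n t * u polet n t - p polet n t * v polet n t) by lra.
  rewrite K; simpl; field; now apply location_neq.
Qed.

(** By [det_pv_qu], p v + q u is 2 q u - kap. *)
Lemma g_is_derive n i t : deforms n -> I01 t -> i <> polet ->
  is_derive (fun t => g i n t) t
    (2 * ((p i n t * u i n t * (q polet n t * v polet n t)
      - p polet n t * u polet n t * (q i n t * v i n t)) / (location i t - t))).
Proof.
  intros Hn Ht Hi.
  apply (is_derive_ext_loc (fun t => 2 * (q i n t * u i n t) + - kap i)).
  - assert (L : locally t (fun s => I01 s)).
    { apply filter_and; [now apply locally_gt|now apply locally_lt]. }
    revert L; apply filter_imp; intros s Hs; rewrite <- (det_pv_qu i n s Hs); simpl; ring.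
  - evar_last.
    + apply is_derive_Rplus; [apply is_derive_scal; now apply qu_is_derive|apply @is_derive_const].
    + unfold zero; simpl; ring.
Qed.

Lemma locally_I01 t : I01 t -> locally t (fun s => I01 s).
Proof.
  intros Ht; apply filter_and; [now apply locally_gt|now apply locally_lt].
Qed.

Lemma pos_coef n : 0 < 2 * INR n + 2 + sig.
Proof. pose proof (pos_INR n); lra. Qed.

Lemma diag_coef_is_derive n t : deforms n -> I01 t ->
  is_derive (a n) t (q polet n t * u polet n t - q polet (S n) t * u polet (S n) t).
Proof.
  intros Hn Ht.
  pose proof (pos_coef n) as HN.
  pose proof (h_neq0 n t Ht) as Hh.
  pose proof (proj1 Hn t Ht) as Dh.
  assert (n0 : pole0 <> polet) by congruence.
  assert (n1 : pole1 <> polet) by congruence.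
  pose proof (pu_is_derive n pole0 t Hn Ht n0) as Da0.
  pose proof (pu_is_derive n pole1 t Hn Ht n1) as Da1.
  pose proof (g_is_derive n pole0 t Hn Ht n0) as Dg0.
  pose proof (g_is_derive n pole1 t Hn Ht n1) as Dg1.
  (* [diag_coef_eq] solved for [a n], with the terms of the pole t eliminated by [sum_g] and
     [sum_pu], since [deforms] gives no derivatives for that pole. *)
  apply (is_derive_ext_loc (fun t =>
    (h n t * (g pole1 n t + t * (- (2 * INR n + sig) - g pole0 n t - g pole1 n t))
     - (p pole1 n t * u pole1 n t + t * t * (0 - p pole0 n t * u pole0 n t - p pole1 n t * u pole1 n t)))
    / (h n t * (2 * INR n + 2 + sig)))).
  - generalize (locally_I01 t Ht); apply filter_imp; intros s Hs.
    pose proof (diag_coef_eq n s Hs) as E.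
    pose proof (sum_g n s Hs) as E1; pose proof (sum_pu n s Hs) as E2.
    pose proof (h_neq0 n s Hs) as Hhs.
    apply (Rmult_eq_reg_r (h n s * (2 * INR n + 2 + sig))); [|apply Rmult_integral_contrapositive; split; lra].
    rewrite E, <- E1, <- E2; field; split; [lra|exact Hhs].
  - evar_last.
    + apply is_derive_div; [| |apply Rmult_integral_contrapositive; split; lra].
      * apply is_derive_Rminus.
        -- apply is_derive_Rmult; [exact Dh|].
           apply is_derive_Rplus; [exact Dg1|].
           apply is_derive_Rmult; [apply @is_derive_id|].
           apply is_derive_Rminus; [|exact Dg1].
           apply is_derive_Rminus; [apply @is_derive_const|exact Dg0].
        -- apply is_derive_Rplus; [exact Da1|].
           apply is_derive_Rmult; [apply is_derive_Rmult; apply @is_derive_id|].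
           apply is_derive_Rminus; [|exact Da1].
           apply is_derive_Rminus; [apply @is_derive_const|exact Da0].
      * apply is_derive_Rmult; [exact Dh|apply @is_derive_const].
    + pose proof (diag_coef_eq n t Ht) as Ea.
      pose proof (sum_g n t Ht) as E1; pose proof (sum_pu n t Ht) as E2.
      pose proof (moment_pu n t Ht) as E4.
      pose proof (sum_qv n t Ht) as E3.
      assert (S2 : 2 * INR n + sig = - (g pole0 n t + g pole1 n t + g polet n t)) by lra.
      assert (A0 : p pole0 n t * u pole0 n t
         = - (p pole1 n t * u pole1 n t) - p polet n t * u polet n t) by lra.
      assert (B0 : q pole0 n t * v pole0 n t
         = - (q pole1 n t * v pole1 n t) - q polet n t * v polet n t) by lra.
      apply (quotient_rule_eq _ _ _ _ (a n t)).
      * apply Rmult_integral_contrapositive; split; lra.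
      * rewrite Ea, S2, A0; simpl; ring.
      * rewrite (q_S polet), (u_S polet) by exact Ht; simpl location.
        replace (2 * INR n + 2 + sig) with (2 + (2 * INR n + sig)) by ring.
        apply Rminus_diag_uniq.
        (* The two sides differ by - g_t times the moment relation. *)
        transitivity (- g polet n t * (p pole1 n t * u pole1 n t
          + t * (p polet n t * u polet n t) + (2 * INR n + 1 + sig) * h n t)).
        -- replace (2 * INR n + 1 + sig) with (1 + (2 * INR n + sig)) by ring.
           rewrite S2, A0, B0; unfold one, zero; simpl; field; lra.
        -- rewrite E4; ring.
Qed.

Lemma deforms_S n : deforms n -> deforms (S n).
Proof.
  intros Hn.
  assert (D : forall i t, I01 t -> i <> polet ->
    is_derive (p i (S n)) t (u polet (S n) t *
      (p i (S n) t * q polet (S n) t - q i (S n) t * p polet (S n) t) / (location i t - t)) /\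
    is_derive (q i (S n)) t (v polet (S n) t *
      (p i (S n) t * q polet (S n) t - q i (S n) t * p polet (S n) t) / (location i t - t)) /\
    is_derive (u i (S n)) t ((u polet (S n) t *
      (u i (S n) t * q polet (S n) t - v i (S n) t * p polet (S n) t)
      - kap polet * u i (S n) t) / (location i t - t)) /\
    is_derive (v i (S n)) t ((v polet (S n) t *
      (u i (S n) t * q polet (S n) t - v i (S n) t * p polet (S n) t)
      - kap polet * v i (S n) t) / (location i t - t))).
  { intros i t Ht Hi.
    pose proof (diag_coef_is_derive n t Hn Ht) as Da.
    destruct Hn as [Dh Dn]; specialize (Dh t Ht).
    destruct (Dn i t Ht Hi) as (Dp & Dq & Du & Dv).
    assert (Dl : is_derive (location i) t 0).
    { destruct i; [apply @is_derive_const|apply @is_derive_const|congruence]. }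
    pose proof (h_neq0 n t Ht) as Hh.
    pose proof (location_neq i t Ht Hi) as Hl.
    pose proof (locally_I01 t Ht) as Loc.
    pose proof (det_pv_qu polet n t Ht) as F.
    assert (K : kap polet = q polet n t * u polet n t - p polet n t * v polet n t) by lra.
    refine (conj _ (conj _ (conj _ _))).
    - apply (is_derive_ext_loc (fun t => (location i t - a n t) * p i n t - h n t * q i n t)).
      + revert Loc; apply filter_imp; intros s Hs; symmetry; now apply p_S.
      + evar_last.
        * apply is_derive_Rminus; [apply is_derive_Rmult; [|exact Dp]|apply is_derive_Rmult; [exact Dh|exact Dq]].
          apply is_derive_Rminus; [exact Dl|exact Da].
        * rewrite !p_S, !q_S, !u_S by exact Ht; change (location polet t) with t.
          simpl; field; auto.
    - apply (is_derive_ext_loc (fun t => p i n t / h n t)).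
      + revert Loc; apply filter_imp; intros s Hs; symmetry; now apply q_S.
      + evar_last.
        * apply is_derive_div; [exact Dp|exact Dh|exact Hh].
        * rewrite !p_S, !q_S, !v_S by exact Ht; change (location polet t) with t.
          simpl; field; auto.
    - apply (is_derive_ext_loc (fun t => (location i t - a n t) * u i n t - h n t * v i n t)).
      + revert Loc; apply filter_imp; intros s Hs; symmetry; now apply u_S.
      + evar_last.
        * apply is_derive_Rminus; [apply is_derive_Rmult; [|exact Du]|apply is_derive_Rmult; [exact Dh|exact Dv]].
          apply is_derive_Rminus; [exact Dl|exact Da].
        * rewrite !p_S, !q_S, !u_S, !v_S by exact Ht; change (location polet t) with t.
          rewrite K; simpl; field; auto.
    - apply (is_derive_ext_loc (fun t => u i n t / h n t)).
      + revert Loc; apply filter_imp; intros s Hs; symmetry; now apply v_S.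
      + evar_last.
        * apply is_derive_div; [exact Du|exact Dh|exact Hh].
        * rewrite !p_S, !q_S, !u_S, !v_S by exact Ht; change (location polet t) with t.
          rewrite K; simpl; field; auto. }
  split; [|exact D].
  intros t Ht.
  assert (n0 : pole0 <> polet) by congruence.
  assert (n1 : pole1 <> polet) by congruence.
  assert (W : forall i, i <> polet -> is_derive (fun t => p i (S n) t * u i (S n) t) t
    ((p i (S n) t * u i (S n) t * g polet (S n) t
      - p polet (S n) t * u polet (S n) t * g i (S n) t) / (location i t - t))).
  { intros i Hi; destruct (D i t Ht Hi) as (Dp & _ & Du & _).
    evar_last; [apply is_derive_Rmult; [exact Dp|exact Du]|].
    pose proof (det_pv_qu polet (S n) t Ht) as F.
    assert (K : kap polet = q polet (S n) t * u polet (S n) t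
      - p polet (S n) t * v polet (S n) t) by lra.
    rewrite K; simpl; field; now apply location_neq. }
  pose proof (pos_INR (S n)) as HN.
  (* [moment_pu] and [sum_pu] combine to N h = (t - 1) p_1 u_1 + t p_0 u_0 at degree n + 1, free of
     the pole t. Differentiating this uses the equations for p and u at the new degree, hence their
     proof before that of [h]. *)
  apply (is_derive_ext_loc (fun t => / (2 * INR (S n) + 1 + sig) *
    ((t - 1) * (p pole1 (S n) t * u pole1 (S n) t) + t * (p pole0 (S n) t * u pole0 (S n) t)))).
  - generalize (locally_I01 t Ht); apply filter_imp; intros s Hs.
    pose proof (moment_pu (S n) s Hs) as E1; pose proof (sum_pu (S n) s Hs) as E2.
    assert (E3 : (s - 1) * (p pole1 (S n) s * u pole1 (S n) s)
       + s * (p pole0 (S n) s * u pole0 (S n) s) = (2 * INR (S n) + 1 + sig) * h (S n) s).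
    { transitivity (- (p pole1 (S n) s * u pole1 (S n) s
        + s * (p polet (S n) s * u polet (S n) s)) + s * (p pole0 (S n) s * u pole0 (S n) s
        + p pole1 (S n) s * u pole1 (S n) s + p polet (S n) s * u polet (S n) s)); [ring|].
      rewrite E1, E2; ring. }
    rewrite E3, <- Rmult_assoc, Rinv_l, Rmult_1_l by lra; reflexivity.
  - evar_last.
    + apply is_derive_scal, is_derive_Rplus; apply is_derive_Rmult.
      * apply is_derive_Rminus; [apply @is_derive_id|apply @is_derive_const].
      * apply W, n1.
      * apply @is_derive_id.
      * apply W, n0.
    + pose proof (sum_pu (S n) t Ht) as E2; pose proof (sum_g (S n) t Ht) as E3.
      assert (S2 : sig = - (g pole0 (S n) t + g pole1 (S n) t + g polet (S n) t)
        - 2 * INR (S n)) by lra.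
      assert (A0 : p pole0 (S n) t * u pole0 (S n) t
         = - (p pole1 (S n) t * u pole1 (S n) t) - p polet (S n) t * u polet (S n) t) by lra.
      simpl location; rewrite A0.
      apply (Rmult_eq_reg_l (2 * INR (S n) + 1 + sig)); [|lra].
      rewrite <- Rmult_assoc, Rinv_r, Rmult_1_l by lra.
      rewrite S2; generalize (INR (S n)); intros m; unfold one, zero; simpl; rewrite ?A0; field; lra.
Qed.

Lemma deforms_all n : deforms n.
Proof.
  induction n as [|n IH]; [|now apply deforms_S].
  split.
  - intros t Ht; rewrite p_0, Rmult_1_l by exact Ht; now apply h_0_is_derive.
  - intros i t Ht Hi; pose proof (locally_I01 t Ht) as Loc.
    pose proof (location_neq i t Ht Hi) as Hl.
    rewrite !p_0, !q_0, !v_0 by exact Ht.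
    refine (conj _ (conj _ (conj _ _))).
    + apply (is_derive_ext_loc (fun _ => 1)).
      * revert Loc; apply filter_imp; intros s Hs; symmetry; now apply p_0.
      * evar_last; [apply @is_derive_const|unfold zero; simpl; field; exact Hl].
    + apply (is_derive_ext_loc (fun _ => 0)).
      * revert Loc; apply filter_imp; intros s Hs; symmetry; now apply q_0.
      * evar_last; [apply @is_derive_const|unfold zero; simpl; field; exact Hl].
    + evar_last; [now apply u_0_is_derive|field; exact Hl].
    + apply (is_derive_ext_loc (fun _ => - kap i)).
      * revert Loc; apply filter_imp; intros s Hs; symmetry; now apply v_0.
      * evar_last; [apply @is_derive_const|unfold zero; simpl; field; exact Hl].
Qed.

Lemma painleve_VI n (S : R -> R) (N := 2 * INR n + 1 + sig) :
  (forall t, I01 t -> S t = pvi_S N t (h n t) (p pole1 n t * u pole1 n t)) ->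
  exists S1 S2 : R -> R,
    (forall t, I01 t -> derivable_pt_lim S t (S1 t)) /\
    (forall t, I01 t -> derivable_pt_lim S1 t (S2 t)) /\
    (forall t, I01 t -> S t <> 0 -> S t <> 1 -> S t <> t ->
       S2 t = PVI_rhs (N ^ 2 / 2) (- (kap pole0 ^ 2 / 2)) (kap pole1 ^ 2 / 2)
         ((1 - kap polet ^ 2) / 2) t (S t) (S1 t)).
Proof.
  intros ES.
  pose proof (deforms_all n) as Hn.
  assert (n0 : pole0 <> polet) by congruence.
  assert (n1 : pole1 <> polet) by congruence.
  assert (HN : N <> 0) by (unfold N; pose proof (pos_INR n); lra).
  set (a0 := fun t => p pole0 n t * u pole0 n t).
  set (a1 := fun t => p pole1 n t * u pole1 n t).
  set (g0 := fun t => g pole0 n t).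
  set (g1 := fun t => g pole1 n t).
  set (b0 := fun t => q pole0 n t * v pole0 n t).
  set (b1 := fun t => q pole1 n t * v pole1 n t).
  assert (Eat : forall t, I01 t -> p polet n t * u polet n t = - a0 t - a1 t).
  { intros t Ht; pose proof (sum_pu n t Ht); unfold a0, a1; lra. }
  assert (Egt : forall t, I01 t -> g polet n t = 1 - N - g0 t - g1 t).
  { intros t Ht; pose proof (sum_g n t Ht); unfold N, g0, g1; lra. }
  assert (Ebt : forall t, I01 t -> q polet n t * v polet n t = - b0 t - b1 t).
  { intros t Ht; pose proof (sum_qv n t Ht); unfold b0, b1; lra. }
  exists (fun t => pvi_S' N t (h n t) (a0 t) (a1 t) (g0 t) (g1 t)).
  exists (fun t => pvi_S'' N t (h n t) (a0 t) (a1 t) (g0 t) (g1 t) (b0 t) (b1 t)).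
  assert (Dh : forall t, I01 t -> is_derive (h n) t (- (- a0 t - a1 t))).
  { intros t Ht; rewrite <- Eat by exact Ht; now apply (proj1 Hn). }
  assert (Da0 : forall t, I01 t -> is_derive a0 t
    ((a0 t * (1 - N - g0 t - g1 t) - (- a0 t - a1 t) * g0 t) / (0 - t))).
  { intros t Ht; rewrite <- Eat, <- Egt by exact Ht; now apply (pu_is_derive n pole0). }
  assert (Da1 : forall t, I01 t -> is_derive a1 t
    ((a1 t * (1 - N - g0 t - g1 t) - (- a0 t - a1 t) * g1 t) / (1 - t))).
  { intros t Ht; rewrite <- Eat, <- Egt by exact Ht; now apply (pu_is_derive n pole1). }
  assert (Dg0 : forall t, I01 t -> is_derive g0 t
    (2 * ((a0 t * (- b0 t - b1 t) - (- a0 t - a1 t) * b0 t) / (0 - t)))).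
  { intros t Ht; rewrite <- Eat, <- Ebt by exact Ht; now apply (g_is_derive n pole0). }
  assert (Dg1 : forall t, I01 t -> is_derive g1 t
    (2 * ((a1 t * (- b0 t - b1 t) - (- a0 t - a1 t) * b1 t) / (1 - t)))).
  { intros t Ht; rewrite <- Eat, <- Ebt by exact Ht; now apply (g_is_derive n pole1). }
  refine (conj _ (conj _ _)); intros t Ht; pose proof (h_neq0 n t Ht) as Hh.
  - apply is_derive_Reals, (is_derive_ext_loc (fun t => pvi_S N t (h n t) (a1 t))).
    + generalize (locally_I01 t Ht); apply filter_imp; intros s Hs; symmetry; now apply ES.
    + apply (pvi_S_is_derive N t (h n) a1 (a0 t) (g0 t) (g1 t)); auto.
  - apply is_derive_Reals.
    apply (pvi_S'_is_derive N t (h n) a0 a1 g0 g1 (b0 t) (b1 t)); auto.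
  - rewrite (ES t Ht); intros H0 H1 H2.
    rewrite (pvi_identity N t (h n t) (a0 t) (a1 t) (g0 t) (g1 t) (b0 t) (b1 t)); auto.
    + pose proof (det_pv_qu pole0 n t Ht) as F0; pose proof (det_pv_qu pole1 n t Ht) as F1.
      pose proof (det_pv_qu polet n t Ht) as F2.
      rewrite <- (Eat t Ht), <- (Egt t Ht), <- (Ebt t Ht).
      unfold a0, a1, g0, g1, b0, b1.
      f_equal; [|f_equal|];
      match goal with |- context [kap ?i] =>
        replace (kap i) with (q i n t * u i n t - p i n t * v i n t) by lra end; field.
    + rewrite <- Eat by exact Ht; unfold a1; rewrite moment_pu by exact Ht; reflexivity.
Qed.

End Schlesinger.

(** * The generalized Jacobi weight as an instance of the Schlesinger system *)

Theorem theorem3p5 (al be ga A B : R) (P : nat -> R -> R -> R) (n : nat) :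
  0 < al -> 0 < be -> 0 < ga ->
  0 <= A -> 0 <= A + B -> ~ (A = 0 /\ A + B = 0) ->
  monic_orthogonal_family al be ga A B P ->
  let S := S_n al be ga A B P n in
  let mu1 := (2 * INR n + al + be + ga + 1) ^ 2 / 2 in
  let mu2 := - (al ^ 2 / 2) in
  let mu3 := be ^ 2 / 2 in
  let mu4 := (1 - ga ^ 2) / 2 in
  exists S1 S2 : R -> R,
    (forall t, 0 < t < 1 -> derivable_pt_lim S t (S1 t)) /\
    (forall t, 0 < t < 1 -> derivable_pt_lim S1 t (S2 t)) /\
    (forall t, 0 < t < 1 -> S t <> 0 -> S t <> 1 -> S t <> t ->
       S2 t = PVI_rhs mu1 mu2 mu3 mu4 t (S t) (S1 t)).
Proof.
  intros Hal Hbe Hga HA HAB Hne HP S mu1 mu2 mu3 mu4.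
  set (L := wint al be ga A B).
  set (Pt := fun t n => P n t).
  set (kap := fun i => match i with pole0 => al | pole1 => be | polet => ga end).
  set (res := fun i t => match i with
    | pole0 => res_0 al be ga A B t
    | pole1 => res_1 al be ga A B t
    | polet => res_t al be ga A B t end).
  set (h := fun n t => sq_norm (L t) (Pt t) n).
  set (u := fun i n t => pole_functional (L t) (location i t) (kap i) (res i t) (P n t)).
  assert (M : forall t, 0 < t < 1 -> forall k, monic k (Pt t k)).
  { intros t Ht k; apply monic_of_deg_monic, (HP t Ht). }
  assert (O : forall t, 0 < t < 1 -> forall m k, m <> k ->
    L t (fun x => Pt t m x * Pt t k x) = 0).
  { intros t Ht m k Hmk; apply has_RInt_unique; now apply (proj2 (HP t Ht)). }
  assert (Lp : forall t n f g, is_poly n f -> is_poly n g ->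
    L t (fun x => f x + g x) = L t f + L t g).
  { intros t; now apply wint_plus. }
  assert (Ls : forall t n k f, is_poly n f -> L t (fun x => k * f x) = k * L t f).
  { intros t; now apply wint_scal. }
  assert (Lm : forall t, 0 < t < 1 -> forall n f, monic n f -> L t (fun x => f x * f x) <> 0).
  { intros t Ht k f; now apply wint_sq_monic. }
  assert (Ld : forall t n g g', is_poly n g -> is_poly n g' ->
    (forall x, is_derive g x (g' x)) ->
    L t (fun x => x * (x - 1) * (x - t) * g' x
     + ((1 + al) * (x - 1) * (x - t) + (1 + be) * x * (x - t) + (1 + ga) * x * (x - 1)) * g x)
    = 0).
  { intros t; now apply wint_total_derivative. }
  assert (R0 : forall t, res pole0 t + res pole1 t + res polet t = 0).
  { intros t; simpl; unfold res_0; ring. }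
  assert (R1 : forall t, res pole1 t + t * res polet t
     = - (1 + al + be + ga) * L t (fun _ => 1)).
  { intros t; simpl; unfold res_1, L; ring. }
  assert (R2 : forall t, 0 < t < 1 -> t * (t - 1) * res polet t
     = (1 + al + ga * (1 - t)) * L t (fun _ => 1) - (2 + al + be + ga) * L t (fun x => x)).
  { intros t Ht; now apply res_t_spec. }
  assert (P0 : forall t, 0 < t < 1 -> forall x, P 0%nat t x = 1).
  { intros t Ht x; destruct (M t Ht 0%nat) as (g & Hg & E).
    unfold Pt in E; rewrite E, Hg; simpl; ring. }
  (* P_0 = 1 has zero difference quotient, so only the constant [res] remains. *)
  assert (u0 : forall i t, 0 < t < 1 -> u i 0%nat t = res i t).
  { intros i t Ht; unfold u.
    rewrite (pole_factor (L t) (location i t) (kap i) (res i t) 0 1 _ (fun _ => 0)).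
    - rewrite (L_zero (L t) (Lp t) (Ls t)) by auto; ring.
    - simpl; auto.
    - intros x; rewrite P0 by exact Ht; ring. }
  assert (Loc : forall t, 0 < t < 1 -> locally t (fun s => 0 < s < 1)).
  { intros t Ht; apply filter_and; [now apply locally_gt|now apply locally_lt]. }
  destruct (painleve_VI kap
    (fun i n t => P n t (location i t))
    (fun i n t => dual (L t) (Pt t) n (location i t)) u
    (fun i n t => pole_dual (L t) (Pt t) (location i t) (kap i) (res i t) n)
    h (fun n t => diag_coef (L t) (Pt t) n)) with (n := n) (S := S) as (S1 & S2 & D1 & D2 & E).
  - intros k t Ht; apply (sq_norm_neq0 (L t) (Lm t Ht) (Pt t) (M t Ht)).
  - intros i k t Ht.
    apply (three_term (L t) (Lp t) (Ls t) (Lm t Ht) (Pt t) (M t Ht) (O t Ht)).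
  - intros i k t Ht.
    apply (pole_three_term (L t) (Lp t) (Ls t) (Lm t Ht) (Pt t) (M t Ht) (O t Ht)).
  - reflexivity.
  - reflexivity.
  - intros i t Ht; now apply P0.
  - reflexivity.
  - reflexivity.
  - intros k t Ht.
    exact (pole_sum_P (L t) (Lp t) (Ls t) t al be ga _ _ _ (R0 t) (R1 t) (R2 t Ht) (Ld t)
      (Pt t) (M t Ht) (O t Ht) k).
  - intros k t Ht.
    refine (eq_trans (pole_moment_P (L t) (Lp t) (Ls t) t al be ga _ _ _ (R0 t) (R1 t) (R2 t Ht)
      (Ld t) (Pt t) (M t Ht) (O t Ht) k) _).
    unfold h; simpl kap; ring.
  - simpl; lra.
  - intros i t Ht Hi.
    rewrite !u0 by exact Ht.
    apply (is_derive_ext_loc (res i)).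
    + generalize (Loc t Ht); apply filter_imp; intros s Hs; symmetry; now apply u0.
    + destruct i; [now apply res_0_is_derive|now apply res_1_is_derive|congruence].
  - intros t Ht; rewrite u0 by exact Ht.
    apply (is_derive_ext_loc (fun s => L s (fun _ => 1))).
    + generalize (Loc t Ht); apply filter_imp; intros s Hs; unfold h, sq_norm.
      f_equal; apply functional_extensionality; intros x; unfold Pt; rewrite P0 by exact Hs; ring.
    + exact (proj1 (moments_is_derive al be ga A B Hal Hbe Hga t Ht)).
  - intros t Ht; unfold S, S_n, R_n, pvi_S, u.
    assert (Eh : h_n al be ga A B P n t = h n t).
    { apply Defs_RInt_unique, has_RInt_of_is_RInt.
      apply (is_RInt_ext (fun x => P n t x * P n t x * weight al be ga A B t x)).
      - intros x _; simpl; ring.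
      - apply (RInt_correct (fun x => P n t x * P n t x * weight al be ga A B t x)), ex_RInt_cont.
        intros x; apply (poly_weight_continuous al be ga A B Hal Hbe Hga t (Datatypes.S n + Datatypes.S n)
          (fun x => P n t x * P n t x)).
        apply poly_mul; apply monic_poly, (M t Ht n). }
    assert (Q : is_poly (Datatypes.S n + Datatypes.S n) (fun x => P n t x * P n t x)).
    { apply poly_mul; apply monic_poly, (M t Ht n). }
    (* [ImpInt01_weight] applies to P_n^2, and [pole_P_sq] factors the result as p_1 u_1. *)
    assert (EI : ImpInt01 (fun y => P n t y ^ 2 * weight al be ga A B t y / (1 - y))
      = - (P n t 1 * pole_functional (L t) 1 be (res pole1 t) (P n t)) / be).
    { pose proof (pole_P_sq (L t) (Lp t) (Ls t) (Pt t) (M t Ht) (O t Ht) 1 be (res pole1 t) n)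
        as EQ; unfold Pt in EQ; rewrite <- EQ; simpl res.
      unfold L; rewrite <- (ImpInt01_weight al be ga A B Hal Hbe Hga t _ _ Ht Q).
      f_equal; apply functional_extensionality; intros y; simpl; unfold Rdiv; ring. }
    rewrite Eh, EI.
    simpl location; simpl kap.
    pose proof (sq_norm_neq0 (L t) (Lm t Ht) (Pt t) (M t Ht) n) as Hh; fold (h n t) in Hh.
    pose proof (pos_INR n).
    field; repeat split; lra || auto.
  - exists S1, S2; refine (conj D1 (conj D2 _)).
    intros t Ht H0 H1 Ht'; rewrite (E t Ht H0 H1 Ht'); simpl kap.
    unfold mu1; f_equal; f_equal; f_equal; ring.
Qed.
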